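(* Let $u^\epsilon$ be the value of the $\epsilon$-obstacle tug-of-war game, $\epsilon\in(0,\gamma]$. As $\epsilon\to0$, $u^\epsilon\to u$ uniformly. The limit $u$ is the unique viscosity solution to the obstacle problem for the infinity Laplacian; that is, $u$ is the unique function that is infinity superharmonic in $\Omega$, i.e. satisfies $$-\Delta_\infty u=-\left\langle D^2u\,\frac{Du}{|Du|},\frac{Du}{|Du|}\right\rangle\ge0\quad\text{in }\Omega\text{ in the viscosity sense},$$ is above the obstacle ($u\ge\Psi$) in $\Omega$, takes the boundary value $F$ on $\Gamma$, and is infinity harmonic (a viscosity solution of $-\Delta_\infty u=0$) in the set where it lies strictly above the obstacle, $\{x\in\Omega:u(x)>\Psi(x)\}$.
   Context: Setting. $\Omega\subset\mathbb R^N$ is a bounded smooth domain, $\gamma>0$ is fixed, and $\Gamma=\{x\in\mathbb R^N\setminus\Omega:\operatorname{dist}(x,\partial\Omega)\le\gamma\}$. The final payoff $F:\Gamma\to\mathbb R$ is Lipschitz, and the obstacle $\Psi:\mathbb R^N\to\mathbb R$ is Lipschitz with $\Psi\le F$ in $\Gamma$. $B_\epsilon(x)$ is the ball of radius $\epsilon$ centered at $x$. Uniform convergence is on $\overline\Omega$ (on $\Gamma$ one has $u^\epsilon=F$), and viscosity solutions of the obstacle problem are continuous functions. The $\epsilon$-obstacle tug-of-war game ($0<\epsilon\le\gamma$). A token starts at $x_0$. If $x_0\in\Gamma$ the game ends at once. At each stage $k$ with $x_k\in\Omega$, Player I may end the game; otherwise each player $i\in\{I,II\}$ chooses an action $a_k^i\in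 B_\epsilon(x_k)$, a fair coin is tossed, and $x_{k+1}=a_k^I$ or $x_{k+1}=a_k^{II}$ with probability $1/2$ each. The game also ends when the token reaches $\Gamma$. When the game ends at position $x_\tau$, Player II pays Player I the amount $\tilde F(x_\tau)$, where $\tilde F=F$ on $\Gamma$ and $\tilde F=\Psi$ on $\Omega$. A strategy $S_i$ of Player $i$ is a sequence of Borel-measurable maps sending each history $(x_0,a_0,x_1,\dots,a_{k-1},x_k)$ (where $a_j=(a_j^I,a_j^{II})$) to a point of $B_\epsilon(x_k)$. A stopping rule $\tau$ for Player I is a finite, Borel-measurable stopping time with values in $\mathbb N=\{0,1,2,\dots\}$ with respect to the histories ($\tau=k$ means that Player I ends the game at stage $k$, if it has not ended already). These data induce a probability on plays with expectation $\mathbb E^{x_0}_{\tau,S_I,S_{II}}$. Let $V_{x_0,I}(\tau,S_I,S_{II})=V_{x_0,II}(\tau,S_I,S_{II})=\mathbb E^{x_0}_{\tau,S_I,S_{II}}[\tilde F(x_\tau)]$ ($x_\tau$ the terminal position) if the game terminates almost surely, and otherwise $V_{x_0,I}=-\infty$, $V_{x_0,II}=+\infty$. The values for the two players are $$u_I^\epsilon(x_0)=\sup_{\tau,S_I}\inf_{S_{II}}V_{x_0,I}(\tau,S_I,S_{II}),\qquad u_{II}^\epsilon(x_0)=\inf_{S_{II}}\sup_{\tau,S_I}V_{x_0,II}(\tau,S_I,S_{II}),$$ and the value of the game is the common function $u^\epsilon=u_I^\epsilon=u_{II}^\epsilon$ on $\Omega\cup\Gamma$ (the two coincide). Viscosity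 sense. A continuous function $v$ on an open set $U$ satisfies $-\Delta_\infty v\ge0$ in $U$ in the viscosity sense if, whenever $x\in U$, $\varphi$ is $C^2$ near $x$ and $v-\varphi$ has a local minimum at $x$, one has $-\langle D^2\varphi(x)D\varphi(x),D\varphi(x)\rangle\ge0$; it satisfies $-\Delta_\infty v\le0$ if $\le0$ holds whenever $v-\varphi$ has a local maximum at $x$; and $-\Delta_\infty v=0$ means both. (The normalized and unnormalized infinity Laplace equations have the same viscosity solutions.) *)

(* Defs.v *)
From HB Require Import structures.
From mathcomp Require Import all_boot all_order all_algebra finmap.
From mathcomp Require Import all_classical all_reals all_analysis.

Set Implicit Arguments.
Unset Strict Implicit.
Unset Printing Implicit Defensive.

Import Order.TTheory GRing.Theory Num.Theory.
Import numFieldNormedType.Exports.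

Local Open Scope classical_set_scope.
Local Open Scope ring_scope.

Section euclidean_space.
Context {R : realType} {N : nat}.
Local Notation V := 'rV[R]_N.
Implicit Types (x y : V) (A U : set V).

(* The library norm on 'rV[R]_N is the sup norm. It is only used through the
   topology, boundedness and the existence of Lipschitz constants, which do not
   depend on the norm; balls and distances are Euclidean. *)
Definition dotv x y : R := \sum_i x 0 i * y 0 i.

Definition enorm x : R := Num.sqrt (dotv x x).

Definition eball x (r : R) : set V := [set y | enorm (y - x) < r].

Definition edist x A : R := inf [set enorm (x - y) | y in A].

Definition bdry A : set V := closure A `\` interior A.

Definition partial (f : V -> R) (i : 'I_N) : V -> R := 'D_(delta_mx 0 i) f.

Definition partials (f : V -> R) (s : seq 'I_N) : V -> R := foldl partial f s.

(* [derive] is total (with an unspecified value when the limit does not exist),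
   hence the separate derivability clause. *)
Definition Ck (k : nat) U (f : V -> R) : Prop :=
  (forall (s : seq 'I_N) x, (size s <= k)%N -> U x ->
     {for x, continuous (partials f s)}) /\
  (forall (s : seq 'I_N) (i : 'I_N) x, (size s < k)%N -> U x ->
     derivable (partials f s) x (delta_mx 0 i)).

Definition Csmooth U (f : V -> R) : Prop := forall k, Ck k U f.

Definition grad (f : V -> R) x : V := \row_i partial f i x.

Definition hess (f : V -> R) x : 'M[R]_N :=
  \matrix_(i, j) partials f [:: i; j] x.

(* Row vectors: [grad f x *m hess f x] is D^2 f D f, the Hessian of a C^2
   function being symmetric. *)
Definition inf_laplacian (f : V -> R) x : R :=
  dotv (grad f x *m hess f x) (grad f x).

Definition domain A : Prop := [/\ open A, connected A & A !=set0].

(* Locally, A is a strict sublevel set of a smooth function which has a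
   nonvanishing gradient at the boundary point. *)
Definition smooth_boundary A : Prop :=
  forall p, bdry A p -> exists U (rho : V -> R),
    [/\ open U, U p, Csmooth U rho, grad rho p != 0
      & forall x, U x -> (A x <-> rho x < 0)].

Definition bounded_smooth_domain A : Prop :=
  [/\ domain A, bounded_set A & smooth_boundary A].

Definition outer_strip A (gamma : R) : set V :=
  [set x | ~ A x /\ edist x (bdry A) <= gamma].

End euclidean_space.

Section viscosity.
Context {R : realType} {N : nat}.
Local Notation V := 'rV[R]_N.
Implicit Types (U Omega Gamma : set V) (v : V -> R).

Definition C2_near (x : V) (phi : V -> R) : Prop :=
  exists2 U : set V, open U /\ U x & Ck 2 U phi.

Definition local_min_at (f : V -> R) (x : V) : Prop :=
  \forall y \near x, f x <= f y.

Definition local_max_at (f : V -> R) (x : V) : Prop :=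
  \forall y \near x, f y <= f x.

(* -Delta_infty v >= 0 in U in the viscosity sense *)
Definition inf_superharmonic U v : Prop :=
  (forall x, U x -> {for x, continuous v}) /\
  forall x (phi : V -> R), U x -> C2_near x phi ->
    local_min_at (v \- phi) x -> 0 <= - inf_laplacian phi x.

(* -Delta_infty v <= 0 in U in the viscosity sense *)
Definition inf_subharmonic U v : Prop :=
  (forall x, U x -> {for x, continuous v}) /\
  forall x (phi : V -> R), U x -> C2_near x phi ->
    local_max_at (v \- phi) x -> - inf_laplacian phi x <= 0.

Definition inf_harmonic U v : Prop :=
  inf_superharmonic U v /\ inf_subharmonic U v.

(* Only the values of v on Omega and Gamma matter. *)
Definition obstacle_solution Omega Gamma (F Psi : V -> R) v : Prop :=
  [/\ {within Omega `|` Gamma, continuous v},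
      inf_superharmonic Omega v,
      (forall x, Omega x -> Psi x <= v x),
      (forall x, Gamma x -> v x = F x)
    & inf_harmonic [set x | Omega x /\ Psi x < v x] v].

End viscosity.

Section histories.
Context (R : realType) (N : nat).

Definition pt := g_sigma_algebraType (@open 'rV[R]_N).

(* (a^I_k, a^II_k, x_{k+1}) *)
Definition round := (pt * pt * pt)%type.

(* (x_0, a_0, x_1, ..., a_{k-1}, x_k) *)
Definition history (k : nat) := (pt * k.-tuple round)%type.

(* (x_0, a_0, x_1, a_1, ...) *)
Definition play := (pt * (nat -> round))%type.

Definition strategy := forall k, history k -> pt.

End histories.

Section game.
Context {R : realType} {N : nat}.
Local Notation V := 'rV[R]_N.

Definition current k (h : history R N k) : V := last h.1 [seq r.2 | r <- h.2].

Definition position (h : play R N) (k : nat) : V :=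
  if k is j.+1 then (h.2 j).2 else h.1.

Definition prefix (k : nat) (h : play R N) : history R N k :=
  (h.1, [tuple h.2 i | i < k]).

(* Strategies are defined on all tuples of points. This is no restriction: a
   strategy on the Borel set of histories that can occur extends by h |-> x_k. *)
Definition strategies (eps : R) : set (strategy R N) :=
  [set S : strategy R N | forall k,
     measurable_fun [set: history R N k] (S k : history R N k -> pt R N) /\
     forall h, eball (current h) eps (S k h)].

(* Finite stopping times: {tau = k} belongs to the sigma-algebra generated by
   the history up to stage k. A stopping time on plays that can occur extends
   by stopping at the first stage violating the rules. *)
Definition stopping_rules : set (play R N -> nat) :=
  [set tau | forall k, exists2 A : set (history R N k), measurable A
                       & [set h | tau h = k] = prefix k @^-1` A].

Section outcome.
Variables (SI SII : strategy R N) (x0 : V) (c : nat -> bool).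

(* The toss c k decides between the moves of Player I (true) and II (false).
   The recursion ignores the end of the game, which is dealt with below. *)
Definition next_round k (h : history R N k) : round R N :=
  (SI h, SII h, if c k then SI h else SII h).

Fixpoint run k : history R N k :=
  if k is j.+1
  then ((run j).1, [tuple of rcons (run j).2 (next_round (run j))])
  else (x0, [tuple]).

Definition outcome : play R N := (x0, fun k => next_round (run k)).

Lemma prefix_outcome k : prefix k outcome = run k.
Proof.
rewrite /prefix /=; elim: k => [|k IH].
  by rewrite /=; congr pair; apply: val_inj => /=; rewrite enum_ord0.
rewrite [RHS]/= -IH /=; congr pair; apply: val_inj => /=.
rewrite enum_ordSr map_rcons -map_comp; congr rcons.
by rewrite IH.
Qed.

End outcome.

Section terminal_payoff.
Variables (Gamma : set V) (F Psi : V -> R) (tau : play R N -> nat).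

Definition ended (h : play R N) (k : nat) : Prop :=
  Gamma (position h k) \/ tau h = k.

Definition terminates (h : play R N) : Prop := exists k, ended h k.

(* the first stage at which the game is over (0 if there is none) *)
Definition end_stage (h : play R N) : nat :=
  xget 0%N [set k | ended h k /\ forall j, (j < k)%N -> ~ ended h j].

Definition payoff (x : V) : R := if `[< Gamma x >] then F x else Psi x.

Definition terminal_payoff (h : play R N) : R :=
  payoff (position h (end_stage h)).

End terminal_payoff.

End game.

Section coins.
Context {d : measure_display} {T : measurableType d} {R : realType}.

Definition fair_coins (P : probability T R) (coin : nat -> {RV P >-> bool}) :
    Prop :=
  (forall k b, P (coin k @^-1` [set b]) = (2^-1)%:E) /\
  (forall (J : {fset nat}) (b : nat -> bool),
     P (\bigcap_(k in [set` J]) coin k @^-1` [set b k]) =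
     (\prod_(k <- J) P (coin k @^-1` [set b k]))%E).

End coins.

(* All the randomness of a play comes from the coin tosses: the law of the play
   is the image of P under omega |-> outcome SI SII x0 (coin^~ omega). *)
Section value.
Context {d : measure_display} {T : measurableType d} {R : realType} {N : nat}.
Local Notation V := 'rV[R]_N.
Variables (P : probability T R) (coin : nat -> {RV P >-> bool}).
Variables (Gamma : set V) (F Psi : V -> R) (eps : R).

Definition terminates_as (tau : play R N -> nat) (SI SII : strategy R N)
    (x0 : V) : Prop :=
  {ae P, forall omega,
     terminates Gamma tau (outcome SI SII x0 (fun k => coin k omega))}.

Definition expected_payoff (tau : play R N -> nat) (SI SII : strategy R N)
    (x0 : V) : \bar R :=
  'E_P[fun omega => terminal_payoff Gamma F Psi tau
                      (outcome SI SII x0 (fun k => coin k omega))].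

Definition V_I tau SI SII x0 : \bar R :=
  if `[< terminates_as tau SI SII x0 >]
  then expected_payoff tau SI SII x0 else -oo%E.

Definition V_II tau SI SII x0 : \bar R :=
  if `[< terminates_as tau SI SII x0 >]
  then expected_payoff tau SI SII x0 else +oo%E.

Definition u_I (x0 : V) : \bar R :=
  ereal_sup [set ereal_inf [set V_I tau SI SII x0 | SII in strategies eps]
            | tau in stopping_rules & SI in strategies eps].

Definition u_II (x0 : V) : \bar R :=
  ereal_inf [set ereal_sup [set V_II tau SI SII x0
                           | tau in stopping_rules & SI in strategies eps]
            | SII in strategies eps].

Definition game_value (Omega : set V) (u : V -> R) : Prop :=
  forall x, (Omega `|` Gamma) x -> u_I x = (u x)%:E /\ u_II x = (u x)%:E.

End value.

(* Main.v *)
Require Import Defs.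
From mathcomp Require Import all_boot all_order all_algebra finmap.
From mathcomp Require Import all_classical all_reals all_analysis.
From mathcomp Require Import measurable_realfun.
From mathcomp Require Import ring lra.

Set Implicit Arguments.
Unset Strict Implicit.
Unset Printing Implicit Defensive.
Import Order.TTheory GRing.Theory Num.Theory.
Import numFieldNormedType.Exports.
Local Open Scope classical_set_scope.
Local Open Scope ring_scope.

(** The link between the game and the equation is comparison with cones.  A
    function lies below cones ([cone_above]) if, on every open subset of the
    domain, it stays below each cone [a + b * |y - x|] with [b >= 0] whose
    vertex lies outside that subset, as soon as it does so on the boundary and
    the cone lies above the obstacle.  For a subsolution the obstacle is [Psi];
    a supersolution is a function whose opposite lies below cones, without any
    obstacle.

    Dynamic programming.  Since both values of the game are equal to [u], the
    identity [u = max(Psi, (sup u + inf u) / 2)] needs no measurable selection: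
    for each of the two inequalities one works with the value for which the
    strategy of the opponent is known in advance.  Then the first move of the
    opponent is known, only two continuations are possible, and near-optimal
    replies to these two can be glued ([value_super], [value_sub]).  As a
    stopping rule is finite, Koenig's lemma shows that the payoff of two fixed
    strategies depends on finitely many tosses ([decided_locally]), so that all
    expectations are finite averages.

    Estimates and limits.  A cone which is bent downwards and lifted off its
    vertex is a strict supersolution of the discrete inequality, so the values
    stay below cones up to an error of order [eps] ([discrete_cone]).  Taking
    the vertex on the strip and then in the domain gives Lipschitz estimates up
    to [O(eps)] ([discrete_lipschitz]).  Hence the upper limits of [u^eps] and
    of [- u^eps] exist, are attained uniformly, are Lipschitz, and lie below
    cones ([upper_limit_cone]).

    Uniqueness.  If [w1] and [- w2] lie below cones and are Lipschitz, then
    their maxima over small balls satisfy the inequality of the game without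
    any error ([ball_max_sub]).  At a point where the difference is largest,
    all these inequalities become equalities and the set of maximum points
    contains a ball around one of its points that is extreme in a coordinate
    direction, which is absurd
    ([cone_comparison], after Armstrong and Smart).  Consequently the upper and
    lower limits agree, which is uniform convergence.

    Viscosity solutions.  A viscosity solution lies on the right side of cones
    because bent cones are strict supersolutions of the equation
    ([viscosity_cone]).  Conversely, inserting a second-order Taylor expansion
    of the test function in the inequality for balls gives the sign of the
    infinity Laplacian ([cone_viscosity]).  So uniqueness holds among viscosity
    solutions, and the limit is one of them. *)

(** * Euclidean geometry and Lipschitz functions *)

Section euclid.
Context {R : realType} {N : nat}.
Local Notation V := 'rV[R]_N.
Implicit Types (x y z : V) (a b r e L : R) (f : V -> R).

Lemma dotvC x y : dotv x y = dotv y x.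
Proof. by apply: eq_bigr => i _; rewrite mulrC. Qed.

Lemma dotvDl x y z : dotv (x + y) z = dotv x z + dotv y z.
Proof. by rewrite /dotv -big_split; apply: eq_bigr => i _; rewrite mxE mulrDl. Qed.

Lemma dotvZl a x y : dotv (a *: x) y = a * dotv x y.
Proof. by rewrite /dotv mulr_sumr; apply: eq_bigr => i _; rewrite mxE mulrA. Qed.

Lemma dotvDr x y z : dotv z (x + y) = dotv z x + dotv z y.
Proof. by rewrite dotvC dotvDl !(dotvC z). Qed.

Lemma dotvZr a x y : dotv x (a *: y) = a * dotv x y.
Proof. by rewrite dotvC dotvZl dotvC. Qed.

Lemma dotvNl x y : dotv (- x) y = - dotv x y.
Proof. by rewrite -scaleN1r dotvZl mulN1r. Qed.

Lemma dotvNr x y : dotv x (- y) = - dotv x y.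
Proof. by rewrite dotvC dotvNl dotvC. Qed.

Lemma dot0v x : dotv 0 x = 0.
Proof. by rewrite -(scale0r 0) dotvZl mul0r. Qed.

Lemma dotvv_ge0 x : 0 <= dotv x x.
Proof. by apply: sumr_ge0 => i _; rewrite -expr2 sqr_ge0. Qed.

Lemma dotvv_eq0 x : (dotv x x == 0) = (x == 0).
Proof.
apply/eqP/eqP => [|->]; last exact: dot0v.
move=> /eqP; rewrite psumr_eq0; last by move=> i _; rewrite -expr2 sqr_ge0.
move=> /allP h; apply/rowP => i; rewrite mxE; apply/eqP.
by have := h i (mem_index_enum i); rewrite mulf_eq0 orbb.
Qed.

Lemma enorm_ge0 x : 0 <= enorm x.
Proof. exact: sqrtr_ge0. Qed.

Lemma enorm_sqr x : enorm x ^+ 2 = dotv x x.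
Proof. exact/sqr_sqrtr/dotvv_ge0. Qed.

Lemma enorm_eq0 x : (enorm x == 0) = (x == 0).
Proof. by rewrite -dotvv_eq0 -enorm_sqr sqrf_eq0. Qed.

Lemma enorm0 : enorm (0 : V) = 0.
Proof. by apply/eqP; rewrite enorm_eq0. Qed.

Lemma enorm_gt0 x : (0 < enorm x) = (x != 0).
Proof. by rewrite lt0r enorm_ge0 andbT enorm_eq0. Qed.

Lemma enormZ a x : enorm (a *: x) = `|a| * enorm x.
Proof.
rewrite /enorm dotvZl dotvZr mulrA -expr2 sqrtrM ?sqr_ge0//.
by rewrite sqrtr_sqr.
Qed.

Lemma enormN x : enorm (- x) = enorm x.
Proof. by rewrite -scaleN1r enormZ normrN1 mul1r. Qed.

Lemma enormB x y : enorm (x - y) = enorm (y - x).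
Proof. by rewrite -enormN opprB. Qed.

Lemma dotv_le_enorm x y : dotv x y <= enorm x * enorm y.
Proof.
have [->|y0] := eqVneq y 0; first by rewrite dotvC dot0v enorm0 mulr0.
have a0 : 0 < dotv y y by rewrite lt0r dotvv_eq0 y0 dotvv_ge0.
have := dotvv_ge0 (dotv y y *: x - dotv x y *: y).
rewrite !(dotvDl, dotvDr, dotvNl, dotvNr, dotvZl, dotvZr) (dotvC y x) => h.
rewrite -sqrtrM ?dotvv_ge0//; apply: le_trans (ler_norm _) _.
rewrite -sqrtr_sqr ler_wsqrtr// -(ler_pM2l a0).
by lra.
Qed.

Lemma enormD x y : enorm (x + y) <= enorm x + enorm y.
Proof.
rewrite -(@ler_pXn2r _ 2) ?nnegrE ?addr_ge0 ?enorm_ge0//.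
rewrite enorm_sqr !(dotvDl, dotvDr) -!enorm_sqr sqrrD (dotvC y x).
by have := dotv_le_enorm x y; lra.
Qed.

Lemma enorm_triangle y x z : enorm (x - z) <= enorm (x - y) + enorm (y - z).
Proof. by rewrite -{1}(subrK y x) -addrA; exact: enormD. Qed.

Lemma coord_le_enorm x i : `|x 0 i| <= enorm x.
Proof.
rewrite -(@ler_pXn2r _ 2) ?nnegrE ?enorm_ge0// enorm_sqr real_normK ?num_real//.
rewrite /dotv (bigD1 i)//= -expr2 lerDl.
by apply: sumr_ge0 => j _; rewrite -expr2 sqr_ge0.
Qed.

(** The topology is that of the sup norm; the two comparisons below make
    Euclidean balls a basis of it. *)
Lemma norm_le_enorm x : `|x| <= enorm x.
Proof.
rewrite {1}/Num.norm/= mx_normrE; apply/bigmax_leP; split; first exact: enorm_ge0.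
by move=> -[i j] _ /=; rewrite ord1 coord_le_enorm.
Qed.

Lemma coord_le_norm x i : `|x 0 i| <= `|x|.
Proof.
rewrite {2}/Num.norm/= mx_normrE; apply/bigmax_geP; right => /=.
by exists (0, i).
Qed.

Lemma enorm_le_norm x : enorm x <= N%:R * `|x|.
Proof.
rewrite -(@ler_pXn2r _ 2) ?nnegrE ?enorm_ge0 ?mulr_ge0//.
rewrite enorm_sqr exprMn.
have h : dotv x x <= N%:R * `|x| ^+ 2.
  rewrite mulr_natl -[in X in _ *+ X](card_ord N) -sumr_const.
  apply: ler_sum => i _; rewrite -expr2 -(@real_normK _ (x 0 i)) ?num_real//.
  by rewrite lerXn2r ?nnegrE// coord_le_norm.
apply: le_trans h _; rewrite ler_wpM2r ?sqr_ge0//.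
by rewrite -natrX ler_nat; case: (N) => // n; rewrite expnS expn1 leq_pmulr.
Qed.

Lemma nbhs_enorm x (A : set V) :
  nbhs x A <-> exists2 r, 0 < r & forall y, enorm (y - x) < r -> A y.
Proof.
split.
  move=> /nbhs_ballP[e /= e0 he]; exists e => // y yx; apply: he.
  rewrite -ball_normE /=; apply: le_lt_trans yx.
  by rewrite -enormN opprB norm_le_enorm.
move=> [r r0 h]; apply/nbhs_ballP; exists (r / N.+1%:R) => /=.
  by rewrite divr_gt0.
move=> y; rewrite -ball_normE /= => xy; apply: h.
apply: le_lt_trans (enorm_le_norm _) _.
apply: (@le_lt_trans _ _ (N.+1%:R * `|x - y|)).
  by rewrite distrC ler_wpM2r// ler_nat.
by rewrite mulrC -ltr_pdivlMr.
Qed.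

Lemma continuous_enormP (f : V -> R) x :
  {for x, continuous f} <->
  forall e : R, 0 < e -> exists2 r, 0 < r &
    forall y, enorm (y - x) < r -> `|f y - f x| < e.
Proof.
split.
  move=> /cvgrPdist_lt h e e0; have /nbhs_enorm[r r0 hr] := h _ e0.
  by exists r => // y /hr; rewrite distrC.
move=> h; apply/(@cvgrPdist_lt _ R V (nbhs x)) => e /h[r r0 hr].
by apply/nbhs_enorm; exists r => // y /hr; rewrite distrC.
Qed.

Lemma open_enormP (A : set V) : open A <->
  forall x, A x -> exists2 r, 0 < r & forall y, enorm (y - x) < r -> A y.
Proof.
by rewrite openE; split=> h x Ax; [have /nbhs_enorm := h x Ax
  | apply/nbhs_enorm/h].
Qed.

Lemma closure_enormP (A : set V) x : closure A x <->
  forall r, 0 < r -> exists2 y, A y & enorm (y - x) < r.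
Proof.
split=> [h r r0|h B /nbhs_enorm[r /h[y Ay yx] hB]]; last by exists y; split => //; exact: hB.
have [y [Ay yx]] := h [set y | enorm (y - x) < r] (proj2 (nbhs_enorm _ _) (ex_intro2 _ _ r r0 (fun _ => id))).
by exists y.
Qed.

Lemma bounded_enormP (A : set V) : bounded_set A <->
  exists M, forall x, A x -> enorm x <= M.
Proof.
split=> [[M [Mr h]]|[M h]].
  exists (N%:R * (M + 1)) => x Ax; apply: le_trans (enorm_le_norm _) _.
  by rewrite ler_wpM2l// h// ltrDl.
exists M; split; first exact: num_real.
by move=> M' MM' x Ax; apply: le_trans (norm_le_enorm _) (le_trans (h _ Ax) (ltW MM')).
Qed.

(** One-sided on purpose: the exchange of [x] and [y] bounds the absolute value,
    see [elip_norm]. *)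
Definition elip (L : R) (A : set V) (f : V -> R) :=
  forall x y, A x -> A y -> f y - f x <= L * enorm (y - x).

Lemma elip_norm L A f x y : elip L A f -> A x -> A y ->
  `|f y - f x| <= L * enorm (y - x).
Proof.
move=> h Ax Ay; rewrite ler_norml h// andbT lerNl opprB.
by rewrite (le_trans (h _ _ Ay Ax))// enormB.
Qed.

Lemma within_enormP (A : set V) (f : V -> R) :
  {within A, continuous f} <->
  forall x e, A x -> 0 < e -> exists2 r, 0 < r &
    forall y, A y -> enorm (y - x) < r -> `|f y - f x| < e.
Proof.
split.
  move=> /subspace_continuousP h x e Ax e0.
  have /cvgrPdist_lt/(_ _ e0) := h x Ax.
  rewrite near_withinE => /nbhs_enorm[r r0 hr].
  by exists r => // y Ay yx; rewrite distrC; exact: hr.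
move=> h; apply/subspace_continuousP => x Ax.
apply/cvgrPdist_lt => e e0; rewrite near_withinE.
have [r r0 hr] := h x e Ax e0.
by apply/nbhs_enorm; exists r => // y yx Ay; rewrite distrC; exact: hr.
Qed.

Lemma elip_within L (A : set V) f : 0 <= L -> elip L A f ->
  {within A, continuous f}.
Proof.
move=> L0 h; apply/within_enormP => x e Ax e0.
have L1 : 0 < L + 1 by rewrite ltr_wpDl.
exists (e / (L + 1)); first by rewrite divr_gt0.
move=> y Ay yx; apply: le_lt_trans (elip_norm h Ax Ay) _.
apply: (@le_lt_trans _ _ ((L + 1) * enorm (y - x))).
  by rewrite ler_wpM2r ?enorm_ge0// lerDl.
by rewrite mulrC -ltr_pdivlMr.
Qed.

Lemma elip_continuous L f : 0 <= L -> elip L setT f -> continuous f.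
Proof.
by move=> L0 /(elip_within L0); rewrite -continuous_subspace_setT.
Qed.

Lemma elipN L (A : set V) f : elip L A f -> elip L A (\- f).
Proof.
by move=> h x y Ax Ay /=; rewrite opprK addrC enormB; exact: h.
Qed.

Lemma elip_enorm x (A : set V) : elip 1 A (fun y => enorm (y - x)).
Proof.
by move=> y z _ _; rewrite mul1r lerBlDr; exact: enorm_triangle.
Qed.

(** McShane's extension: an infimum of cones with slope [L] is [L]-Lipschitz. *)
Lemma elip_extend L (A : set V) f : A !=set0 -> 0 <= L -> elip L A f ->
  exists g, elip L setT g /\ forall x, A x -> g x = f x.
Proof.
move=> [a Aa] L0 h.
pose S x := [set f z + L * enorm (x - z) | z in A].
have Slb x : has_inf (S x).
  split; first by exists (f a + L * enorm (x - a)), a.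
  exists (f a - L * enorm (x - a)) => _ [z Az <-].
  have := h z a Az Aa; have := enorm_triangle x a z; rewrite (enormB a x).
  by move=> /(ler_wpM2l L0); lra.
exists (fun x => inf (S x)); split=> [x y _ _|x Ax].
  rewrite lerBlDr -lerBlDl; apply: lb_le_inf; first by case: (Slb x).
  move=> _ [z Az <-]; rewrite lerBlDl.
  apply: (@le_trans _ _ (f z + L * enorm (y - z))).
    by apply: ge_inf; [case: (Slb y)|exists z].
  have := enorm_triangle x y z.
  by move=> /(ler_wpM2l L0); lra.
apply/eqP; rewrite eq_le; apply/andP; split.
  apply: ge_inf; first by case: (Slb x).
  by exists x => //; rewrite subrr enorm0 mulr0 addr0.
apply: lb_le_inf; first by case: (Slb x).
by move=> _ [z Az <-]; rewrite -lerBlDl; exact: h.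
Qed.

Lemma closed_enorm_ball x r : closed [set y | enorm (y - x) <= r].
Proof.
apply: (@closed_comp _ _ (fun y => enorm (y - x)) [set t | t <= r]).
  by move=> y _; apply: (elip_continuous ler01 (@elip_enorm x setT)).
exact: closed_le.
Qed.

Lemma compact_enorm_ball x r : compact [set y : V | enorm (y - x) <= r].
Proof.
apply: bounded_closed_compact; last exact: closed_enorm_ball.
apply/bounded_enormP; exists (r + enorm x) => y /= yx.
by have := enorm_triangle x y 0; rewrite !subr0; lra.
Qed.

Lemma max_on_compact (A : set V) (f : V -> R) : A !=set0 -> compact A ->
  {within A, continuous f} -> exists2 c, A c & forall y, A y -> f y <= f c.
Proof.
move=> A0 cA cf; have [c /[!inE] Ac hc] := EVT_max_rV A0 cA cf.
by exists c => // y Ay; apply: hc; rewrite inE.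
Qed.

(** Packaged as a compact set so that it can be iterated: maximising several
    functions one after the other selects an extreme maximum point. *)
Lemma compact_argmax (A : set V) (f : V -> R) : A !=set0 -> compact A ->
  continuous f ->
  exists B, [/\ B !=set0, compact B, B `<=` A
    & forall x, B x <-> A x /\ forall y, A y -> f y <= f x].
Proof.
move=> A0 cA cf; have [c Ac hc] := max_on_compact A0 cA (continuous_subspaceT cf).
exists (A `&` f @^-1` [set t | f c <= t]); split.
- by exists c; split => //=.
- apply: compact_closedI => //; apply: closed_comp; last exact: closed_ge.
  by move=> y _; exact: cf.
- by move=> x [].
- move=> x; split=> [[Ax /= fx]|[Ax h]]; last by split => //=; exact: h.
  by split=> // y Ay; exact: le_trans (hc _ Ay) fx.
Qed.

(** The infimum of the parameters for which the segment is outside the open set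
    is attained, because the complement is closed. *)
Lemma segment_exit (A : set V) x y : open A -> A x -> ~ A y ->
  exists2 p, closure A p /\ ~ A p &
    enorm (p - x) <= enorm (y - x) /\
    enorm (y - x) = enorm (p - x) + enorm (y - p).
Proof.
move=> /open_enormP oA Ax nAy.
pose pos t := x + t *: (y - x).
pose S := [set t : R | 0 <= t <= 1 /\ ~ A (pos t)].
have S1 : S 1 by split; [rewrite ler01 lexx|rewrite /pos scale1r addrC subrK].
have Sinf : has_inf S by split; [exists 1|exists 0 => t [/andP[]]].
have posB s t : enorm (pos s - pos t) = `|s - t| * enorm (y - x).
  by rewrite -enormZ scalerBl /pos opprD addrACA subrr add0r.
pose t0 := inf S.
have t00 : 0 <= t0 by apply: lb_le_inf; [exists 1|move=> t [/andP[]]].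
have t01 : t0 <= 1 by apply: ge_inf => //; case: Sinf.
have d0 : 0 < enorm (y - x) + 1 by rewrite ltr_wpDl ?enorm_ge0.
have close s r : 0 < r -> `|s - t0| < r / (enorm (y - x) + 1) ->
    enorm (pos s - pos t0) < r.
  move=> r0; rewrite ltr_pdivlMr// posB; apply: le_lt_trans.
  by rewrite ler_wpM2l// lerDl.
have nA : ~ A (pos t0).
  move=> /oA[r r0 hr].
  have [t [/andP[t0' t1'] nAt] tlt] : exists2 t, S t & t < t0 + r / (enorm (y - x) + 1).
    by apply: inf_adherent => //; rewrite divr_gt0.
  have tt : t0 <= t.
    by apply: ge_inf; [case: Sinf|split => //; apply/andP; split].
  apply: nAt; apply: hr; apply: close => //.
  by rewrite ger0_norm ?subr_ge0//; lra.
exists (pos t0); last first.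
  have px : enorm (pos t0 - x) = t0 * enorm (y - x).
    by rewrite /pos addrC addKr enormZ ger0_norm.
  have yp : enorm (y - pos t0) = (1 - t0) * enorm (y - x).
    have -> : y - pos t0 = (1 - t0) *: (y - x).
      by rewrite scalerBl scale1r /pos opprD addrA.
    by rewrite enormZ ger0_norm// subr_ge0.
  by rewrite px yp; split; [rewrite ler_piMl ?enorm_ge0|lra].
split => //; apply/closure_enormP => r r0.
have t0gt : 0 < t0.
  rewrite lt0r t00 andbT; apply/eqP => t0e.
  by apply: nA; rewrite t0e /pos scale0r addr0.
pose s := Num.max 0 (t0 - r / (enorm (y - x) + 1) / 2).
have rr : 0 < r / (enorm (y - x) + 1) by rewrite divr_gt0.
have st : s < t0 by rewrite /s gt_max t0gt/=; lra.
have s0 : 0 <= s by rewrite /s le_max lexx.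
exists (pos s).
  apply: contrapT => nAs.
  have : t0 <= s by apply: ge_inf; [case: Sinf|split => //; apply/andP; split => //; lra].
  by lra.
apply: close => //; rewrite ltr0_norm ?subr_lt0//.
have : t0 - r / (enorm (y - x) + 1) / 2 <= s by rewrite /s le_max lexx orbT.
by lra.
Qed.

End euclid.

(** * Expectations of payoffs decided by finitely many tosses *)

Section coin_averages.
Context {d : measure_display} {T : measurableType d} {R : realType}.
Variables (P : probability T R) (coin : nat -> {RV P >-> bool}).
Hypothesis fair : fair_coins coin.
Implicit Types (g : (nat -> bool) -> R) (c : nat -> bool).

Definition ccons (b : bool) c : nat -> bool := fun k => if k is j.+1 then c j else b.

Lemma ccons_eta c : c = ccons (c 0%N) (fun k => c k.+1).
Proof. by apply/funext => -[]. Qed.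

Definition finite_horizon n g :=
  forall c c', (forall k, (k < n)%N -> c k = c' k) -> g c = g c'.

Fixpoint avg n g : R :=
  if n is m.+1 then (avg m (g \o ccons true) + avg m (g \o ccons false)) / 2
  else g (fun=> false).

Lemma finite_horizon_ccons n g b :
  finite_horizon n.+1 g -> finite_horizon n (g \o ccons b).
Proof. by move=> h c c' cc'; apply: h => -[//|k]; exact: cc'. Qed.

Definition cyl n c : set T := [set w | forall k, (k < n)%N -> coin k w = c k].

Lemma cyl0 c : cyl 0 c = setT.
Proof. by apply/seteqP; split. Qed.

Lemma measurable_coin k (B : set bool) : measurable (coin k @^-1` B).
Proof. by rewrite -[X in measurable X]setTI; exact: measurable_funP. Qed.

Lemma cylS n c : cyl n.+1 c = cyl n c `&` coin n @^-1` [set c n].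
Proof.
apply/seteqP; split=> [w h|w [h1 h2] k].
  by split=> [k kn|]; apply: h => //; exact: ltnW.
by rewrite ltnS leq_eqVlt => /orP[/eqP->//|]; exact: h1.
Qed.

Lemma measurable_cyl n c : measurable (cyl n c).
Proof.
elim: n => [|n IH]; first by rewrite cyl0.
by rewrite cylS; apply: measurableI => //; exact: measurable_coin.
Qed.

Lemma cyl_fair n c : P (cyl n c) = ((2^-1) ^+ n)%:E.
Proof.
case: fair => half indep.
have -> : cyl n c =
    \bigcap_(k in [set` [fset k in iota 0 n]%fset]) coin k @^-1` [set c k].
  apply/seteqP; split => w h k /=.
    by rewrite inE /= mem_iota /= add0n; exact: h.
  by move=> kn; apply: (h k); rewrite /= inE /= mem_iota.
rewrite indep (eq_bigr (fun=> (2^-1)%:E)); last by move=> k _; exact: half.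
rewrite big_const_seq count_predT.
have -> : size [fset k in iota 0 n]%fset = n.
  by have := card_fseq (iota 0 n); rewrite undup_id ?iota_uniq// size_iota.
by elim: n => [|n IH]; rewrite ?expr0//= IH exprS EFinM.
Qed.

Lemma finite_horizon_measurable n g m : finite_horizon n g ->
  measurable_fun [set: T] (fun w => g (fun k => coin (m + k)%N w)).
Proof.
elim: n g m => [|n IH] g m h.
  rewrite (_ : (fun _ => _) = cst (g (fun=> false))) //.
  by apply/funext => w; exact: h.
rewrite (_ : (fun _ => _) = fun w => if coin m w
    then (g \o ccons true) (fun k => coin (m.+1 + k)%N w)
    else (g \o ccons false) (fun k => coin (m.+1 + k)%N w)).
  apply: measurable_fun_ifT; first exact: measurable_funP.
    by apply: IH; exact: finite_horizon_ccons.
  by apply: IH; exact: finite_horizon_ccons.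
apply/funext => w; rewrite [X in g X]ccons_eta addn0 /=.
by case: ifP => _; congr g; apply/funext => -[//|k] /=; rewrite addnS.
Qed.

(** Each toss splits a cylinder in two halves of equal probability, whence the
    expectation is the average over the leaves of a binary tree. *)
Lemma integral_cyl n g m c : finite_horizon n g ->
  (\int[P]_(w in cyl m c) (g (fun k => coin (m + k)%N w))%:E =
   (avg n g * (2^-1) ^+ m)%:E)%E.
Proof.
elim: n g m c => [|n IH] g m c h.
  rewrite (eq_integral (cst (g (fun=> false))%:E)); last first.
    by move=> w _ /=; congr EFin; exact: h.
  transitivity ((g (fun=> false))%:E * P (cyl m c))%E; last by rewrite cyl_fair.
  exact: (integral_cst _ (measurable_cyl m c)).
pose cb b := fun k => if k == m then b else c k.
have cylE b : cyl m.+1 (cb b) = cyl m c `&` coin m @^-1` [set b].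
  rewrite cylS /cb eqxx; congr (_ `&` _).
  by apply/seteqP; split => w h' k km; rewrite h'// ltn_eqF.
have -> : cyl m c = cyl m.+1 (cb true) `|` cyl m.+1 (cb false).
  rewrite !cylE -setIUr; apply/seteqP; split => [w h'|w [] //].
  by split=> //=; case: (coin m w); [left|right].
rewrite integral_setU; [|exact: measurable_cyl|exact: measurable_cyl| |]; last 2 first.
- apply: (@measurable_funS _ _ _ _ setT) => //.
  by apply/measurable_EFinP; exact: (@finite_horizon_measurable n.+1 g m).
- rewrite disj_set2E; apply/eqP/seteqP; split => // w []; rewrite !cylE.
  by move=> [_ /= ->] [_ /=].
have E b : (\int[P]_(w in cyl m.+1 (cb b)) (g (fun k => coin (m + k)%N w))%:E =
    (avg n (g \o ccons b) * 2^-1 ^+ m.+1)%:E)%E.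
  rewrite -(IH _ m.+1 (cb b)); last exact: finite_horizon_ccons.
  apply: eq_integral => w; rewrite inE cylE => -[_ /= cw]; congr EFin.
  rewrite [X in g X]ccons_eta addn0 cw; congr g.
  by apply/funext => -[//|k] /=; rewrite addnS.
by rewrite !E -EFinD; congr EFin; rewrite /= exprS; field.
Qed.

Lemma expectation_avg n g : finite_horizon n g ->
  ('E_P[fun w => g (fun k => coin k w)] = (avg n g)%:E)%E.
Proof.
move=> h; rewrite unlock.
by have := integral_cyl 0 (fun=> false) h; rewrite cyl0 expr0 mulr1.
Qed.

Definition decided g := exists n, finite_horizon n g.

Definition mean g : R := fine ('E_P[fun w => g (fun k => coin k w)])%E.

Lemma mean_avg n g : finite_horizon n g -> mean g = avg n g.
Proof. by move=> h; rewrite /mean (expectation_avg h). Qed.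

Lemma decided_expectation g : decided g ->
  ('E_P[fun w => g (fun k => coin k w)] = (mean g)%:E)%E.
Proof. by move=> [n h]; rewrite (mean_avg h) (expectation_avg h). Qed.

Lemma finite_horizonW n g : finite_horizon n g -> finite_horizon n.+1 g.
Proof. by move=> h c c' cc'; apply: h => k kn; apply: cc'; exact: ltnW. Qed.

(** Conditioning on the first toss: by fairness and independence, the law of
    the remaining tosses is that of the whole sequence. *)
Lemma mean_first_toss g : decided g ->
  mean g = (mean (g \o ccons true) + mean (g \o ccons false)) / 2.
Proof.
move=> [n /finite_horizonW h]; rewrite (mean_avg h) /=.
by rewrite !(@mean_avg n)//; exact: finite_horizon_ccons.
Qed.

Lemma avg_le n g C : (forall c, g c <= C) -> avg n g <= C.
Proof.
elim: n g => [|n IH] g h //=.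
rewrite ler_pdivrMr// mulr_natr mulr2n; apply: lerD; apply: IH => c; exact: h.
Qed.

Lemma avg_ge n g C : (forall c, C <= g c) -> C <= avg n g.
Proof.
elim: n g => [|n IH] g h //=.
rewrite ler_pdivlMr// mulr_natr mulr2n; apply: lerD; apply: IH => c; exact: h.
Qed.

Lemma mean_le g C : decided g -> (forall c, g c <= C) -> mean g <= C.
Proof. by move=> [n h]; rewrite (mean_avg h); exact: avg_le. Qed.

Lemma mean_ge g C : decided g -> (forall c, C <= g c) -> C <= mean g.
Proof. by move=> [n h]; rewrite (mean_avg h); exact: avg_ge. Qed.

Lemma mean_eq_cst g C : (forall c, g c = C) -> mean g = C.
Proof.
move=> h; have dg : decided g by exists 0%N => c c' _; rewrite !h.
by apply/eqP; rewrite eq_le mean_le ?mean_ge// => c; rewrite h.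
Qed.

(** Koenig's lemma: if every sequence of tosses settles the payoff in finite
    time, then some deterministic time settles it for all of them, since
    otherwise one could choose tosses one after the other so that the payoff
    is never settled. *)
Lemma decided_locally g :
  (forall c, exists n, forall c', (forall k, (k < n)%N -> c' k = c k) ->
     g c' = g c) -> decided g.
Proof.
move=> loc; apply: contrapT => ndec.
have split_g g' : ~ decided g' -> {b | ~ decided (g' \o ccons b)}.
  move=> nd; case: (pselect (decided (g' \o ccons true))) => [dt|]; last by exists true.
  exists false => -[n hf]; apply: nd; case: dt => m ht.
  exists (maxn m n).+1 => c c' cc'.
  rewrite (ccons_eta c) (ccons_eta c') -(cc' 0%N)//.
  case: (c 0%N); [apply: ht|apply: hf] => k k1; apply: cc'; rewrite ltnS.
    exact: leq_trans k1 (leq_maxl _ _).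
  exact: leq_trans k1 (leq_maxr _ _).
pose U := {g' | ~ decided g'}.
pose step (u : U) : U :=
  exist (fun g' => ~ decided g') (sval u \o ccons (sval (split_g _ (svalP u))))
    (svalP (split_g _ (svalP u))).
pose path k : U := iter k step (exist (fun g' => ~ decided g') g ndec).
pose c k := sval (split_g _ (svalP (path k))).
pose prepend n c' := fun k => if (k < n)%N then c k else c' (k - n)%N.
have pathE n c' : sval (path n) c' = g (prepend n c').
  elim: n c' => [|n IH] c'.
    by rewrite /prepend /=; congr g; apply/funext => k; rewrite subn0.
  rewrite /path iterS -/(path n) /= IH; congr g; apply/funext => k.
  rewrite /prepend; case: ltngtP => [kn|kn|->].
  - by rewrite (ltn_trans kn).
  - by rewrite ltnS leqNgt kn /= -(@prednK (k - n)) ?subn_gt0//= subnS.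
  - by rewrite ltnSn subnn.
have [n hn] := loc c.
case: (svalP (path n)); exists 0%N => c1 c2 _; rewrite !pathE.
by rewrite !(hn (prepend _ _)) // => k kn; rewrite /prepend kn.
Qed.

End coin_averages.

(** * Histories, plays and payoffs as functions of the tosses *)

Section game_tree.
Context {R : realType} {N : nat}.
Local Notation V := 'rV[R]_N.
Local Notation pt := (pt R N).
Local Notation play := (play R N).
Local Notation history := (history R N).
Local Notation strategy := (strategy R N).
Local Notation prefix := Defs.prefix.
Implicit Types (x a b : pt) (SI SII : strategy) (tau : play -> nat)
  (c : nat -> bool).

Definition start x : history 0 := (x, [tuple]).

Definition hcons x a b k (h : history k) : history k.+1 :=
  (x, [tuple of (a, b, h.1) :: h.2]).

Definition htail k (h : history k.+1) : history k :=
  ((thead h.2).2, [tuple of behead h.2]).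

(** The first point of [h] is the one reached in the first round, so the play
    [h] becomes the continuation of a play from [x]. *)
Definition pcons x a b (h : play) : play :=
  (x, fun k => if k is j.+1 then h.2 j else (a, b, h.1)).

Definition ptail (h : play) : play := ((h.2 0%N).2, fun k => h.2 k.+1).

Lemma prefix_pcons x a b h k :
  prefix k.+1 (pcons x a b h) = hcons x a b (prefix k h).
Proof.
rewrite /prefix /hcons /=; congr pair; apply/val_inj => /=.
by rewrite enum_ordSl /= -map_comp.
Qed.

Lemma prefix_ptail h k : prefix k (ptail h) = htail (prefix k.+1 h).
Proof.
rewrite /prefix /htail /=; congr pair; first by rewrite /thead tnth_map tnth_ord_tuple.
by apply/val_inj => /=; rewrite enum_ordSl /= -map_comp.
Qed.

Lemma current_hcons x a b k (h : history k) : current (hcons x a b h) = current h.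
Proof. by []. Qed.

Lemma current_htail k (h : history k.+1) : current (htail h) = current h.
Proof.
by rewrite /current /htail /=; case: h => y t; rewrite [in RHS](tuple_eta t).
Qed.

Lemma position_prefix h k : position h k = @current R N k (prefix k h).
Proof.
elim: k h => [|k IH] h; first by rewrite /current /prefix /= enum_ord0.
by rewrite -current_htail -prefix_ptail -IH; case: k {IH}.
Qed.

Lemma run_agree SI SII x c c' k : (forall j, (j < k)%N -> c j = c' j) ->
  run SI SII x c k = run SI SII x c' k.
Proof.
elim: k => [//|k IH] h /=; rewrite IH; last by move=> j jk; apply: h; exact: ltnW.
by rewrite /next_round h.
Qed.

Lemma stopping_prefix tau h h' k : stopping_rules tau ->
  prefix k h = prefix k h' -> tau h = k -> tau h' = k.
Proof.
move=> /(_ k)[A _ EA] hh' th.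
have : [set h | tau h = k] h by [].
by rewrite EA /= hh' => Ah'; have : [set h | tau h = k] h' by rewrite EA.
Qed.

Lemma runS SI SII x c k : run SI SII x c k.+1 =
  ((run SI SII x c k).1,
   [tuple of rcons (run SI SII x c k).2 (next_round SI SII c (run SI SII x c k))]).
Proof. by []. Qed.

Lemma run1 SI SII x c k : (run SI SII x c k).1 = x.
Proof. by elim: k. Qed.

Section outcome_first_round.
Variables (SI SII SI' SII' : strategy) (x : pt) (t : bool).
Let a := SI (start x).
Let b := SII (start x).
Let x1 := if t then a else b.
Hypothesis eqI :
  forall k (h : history k), h.1 = x1 -> SI (hcons x a b h) = SI' h.
Hypothesis eqII :
  forall k (h : history k), h.1 = x1 -> SII (hcons x a b h) = SII' h.

Lemma run_ccons c k :
  run SI SII x (ccons t c) k.+1 = hcons x a b (run SI' SII' x1 c k).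
Proof.
elim: k => [|k IH].
  by rewrite /hcons /next_round /=; congr pair; exact/val_inj.
rewrite runS IH [in RHS]runS /next_round eqI; last exact: run1.
rewrite eqII; last exact: run1.
by congr pair; exact/val_inj.
Qed.

Lemma outcome_ccons c :
  outcome SI SII x (ccons t c) = pcons x a b (outcome SI' SII' x1 c).
Proof.
rewrite /outcome /pcons; congr pair; apply/funext => -[//|k] /=.
rewrite -/(run SI SII x (ccons t c) k.+1) run_ccons /next_round.
by rewrite eqI ?eqII//; exact: run1.
Qed.

End outcome_first_round.

Section payoff_of_tosses.
Variables (Gam : set V) (F Psi : V -> R).

Lemma ended_prefix tau h h' k : stopping_rules tau -> prefix k h = prefix k h' ->
  ended Gam tau h k -> ended Gam tau h' k.
Proof.
move=> st hh' [|th]; last by right; exact: stopping_prefix hh' th.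
by rewrite position_prefix hh' -position_prefix; left.
Qed.

Lemma terminatesT tau h : terminates Gam tau h.
Proof. by exists (tau h); right. Qed.

Lemma end_stageP tau h :
  ended Gam tau h (end_stage Gam tau h) /\
  forall j, (j < end_stage Gam tau h)%N -> ~ ended Gam tau h j.
Proof.
rewrite /end_stage; case: xgetP => [k -> //|none]; exfalso.
have [k0 hk0] := terminatesT tau h.
have ex : exists k, `[< ended Gam tau h k >] by exists k0; exact/asboolP.
case: (ex_minnP ex) => k /asboolP ek mink; apply: (none k); split => // j jk ej.
by have := mink j; rewrite asboolT// leqNgt jk => /(_ isT).
Qed.

Lemma end_stage_uniq tau h k : ended Gam tau h k ->
  (forall j, (j < k)%N -> ~ ended Gam tau h j) -> end_stage Gam tau h = k.
Proof.
move=> ek mink; have [es ns] := end_stageP tau h; apply/eqP.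
rewrite eqn_leq; apply/andP; split; rewrite leqNgt; apply/negP.
  by move=> /ns; exact.
by move=> /mink; exact.
Qed.

Definition toss_payoff tau SI SII x c : R :=
  terminal_payoff Gam F Psi tau (outcome SI SII x c).

(** Whether the game has ended at stage [k] depends on the first [k] tosses, and
    a stopping rule is finite, so along each sequence of tosses the payoff is
    settled in finite time. *)
Lemma toss_payoff_decided tau SI SII x : stopping_rules tau ->
  decided (toss_payoff tau SI SII x).
Proof.
move=> st; apply: decided_locally => c.
exists (end_stage Gam tau (outcome SI SII x c)) => c' cc'.
set h := outcome SI SII x c; set h' := outcome SI SII x c'.
set k := end_stage Gam tau h in cc' *.
have [ek nk] := end_stageP tau h.
have pre j : (j <= k)%N -> prefix j h' = prefix j h.
  move=> jk; rewrite !prefix_outcome; apply: run_agree => i ij; apply: cc'.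
  exact: leq_trans ij jk.
have -> : toss_payoff tau SI SII x c' = payoff Gam F Psi (position h' k).
  rewrite /toss_payoff /terminal_payoff -/h'; congr (payoff _ _ _ (position _ _)).
  apply: end_stage_uniq => [|j jk ej].
    by apply: ended_prefix ek => //; rewrite pre.
  apply: (nk j jk); apply: ended_prefix ej => //; rewrite pre//; exact: ltnW.
by rewrite position_prefix pre// -position_prefix.
Qed.

(** Once the game has survived its first stage, the rest of it is a game
    started at the point reached after the first toss. *)
Lemma toss_payoff_ccons tau tau' SI SII SI' SII' x t c :
  let a := SI 0%N (start x) in
  let b := SII 0%N (start x) in
  let x1 := if t then a else b in
  ~ Gam x ->
  (forall k (h : history k), h.1 = x1 -> SI k.+1 (hcons x a b h) = SI' k h) ->
  (forall k (h : history k), h.1 = x1 -> SII k.+1 (hcons x a b h) = SII' k h) ->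
  (forall h : play, h.1 = x1 -> tau (pcons x a b h) = (tau' h).+1) ->
  toss_payoff tau SI SII x (ccons t c) = toss_payoff tau' SI' SII' x1 c.
Proof.
move=> a b x1 nGx eqI eqII eqt.
rewrite /toss_payoff (outcome_ccons eqI eqII) -/a -/b -/x1.
set h := outcome SI' SII' x1 c.
have eqh : tau (pcons x a b h) = (tau' h).+1 by exact: eqt.
have endS k : ended Gam tau (pcons x a b h) k.+1 <-> ended Gam tau' h k.
  rewrite /ended eqh.
  have -> : position (pcons x a b h) k.+1 = position h k by case: k.
  by split=> [[?|[?]]|[?|->]]; [left|right|left|right].
rewrite /terminal_payoff.
have [ek nk] := end_stageP tau' h.
have -> : end_stage Gam tau (pcons x a b h) = (end_stage Gam tau' h).+1.
  apply: end_stage_uniq; first exact/endS.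
  move=> [_|j jk /endS]; last exact: nk.
  by case=> //; rewrite eqh.
by congr (payoff _ _ _ _); case: (end_stage _ _ _).
Qed.

Lemma toss_payoff_stop tau SI SII x c : tau (outcome SI SII x c) = 0%N ->
  toss_payoff tau SI SII x c = payoff Gam F Psi x.
Proof.
move=> t0; rewrite /toss_payoff /terminal_payoff.
by have -> : end_stage Gam tau (outcome SI SII x c) = 0%N
  by apply: end_stage_uniq => //; right.
Qed.

Lemma toss_payoff_final tau SI SII x c : Gam x ->
  toss_payoff tau SI SII x c = F x.
Proof.
move=> Gx; rewrite /toss_payoff /terminal_payoff.
have -> : end_stage Gam tau (outcome SI SII x c) = 0%N
  by apply: end_stage_uniq => //; left.
by rewrite /payoff asboolT.
Qed.

End payoff_of_tosses.
End game_tree.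

(** * Gluing strategies and stopping rules *)

Section gluing.
Context {R : realType} {N : nat}.
Local Notation V := 'rV[R]_N.
Local Notation pt := (pt R N).
Local Notation play := (play R N).
Local Notation history := (history R N).
Local Notation strategy := (strategy R N).
Local Notation prefix := Defs.prefix.
Implicit Types (x a b : pt) (S : strategy) (tau : play -> nat).

Lemma measurable_point a : measurable ([set a] : set pt).
Proof.
rewrite -(setCK [set a]); apply: measurableC; apply: sub_sigma_algebra.
apply/(@open_enormP R N) => y /eqP ya; exists (enorm ((y : V) - a)).
  by rewrite enorm_gt0 subr_eq0.
by move=> z h /= za; move: h; rewrite za enormB ltxx.
Qed.

Lemma measurable_htail k : measurable_fun [set: history k.+1] (@htail R N k).
Proof.
apply: measurable_fun_pair.
  apply: measurableT_comp => //.
  apply: (@measurableT_comp _ _ _ _ _ _ (fun t : k.+1.-tuple _ => thead t)) => //.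
  exact: measurable_tnth.
apply: (@measurableT_comp _ _ _ _ _ _ (fun t : k.+1.-tuple (round R N) => [tuple of behead t])) => //.
exact: measurable_behead.
Qed.

Lemma measurable_hcons x a b k : measurable_fun [set: history k] (@hcons R N x a b k).
Proof.
apply: measurable_fun_pair => //; apply: measurable_cons => //.
by apply: measurable_fun_pair.
Qed.

Lemma measurable_current k : measurable_fun [set: history k] (@current R N k : history k -> pt).
Proof.
elim: k => [|k IH].
  rewrite (_ : current (k:=0) = (fst : history 0 -> pt)) //.
  by apply/funext => -[y t]; rewrite /current /= (tuple0 t).
rewrite (_ : current (k:=k.+1) = (@current R N k : history k -> pt) \o (@htail R N k)).
  by apply: measurableT_comp => //; exact: measurable_htail.
by apply/funext => h /=; rewrite current_htail.
Qed.

Definition stay : strategy := fun k h => current h.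

(** The strategy that [S] prescribes once the actions [a] and [b] have been
    taken at [x]: the point reached is the first point of the new history. *)
Definition after x a b S : strategy := fun k h => S k.+1 (hcons x a b h).

(** The toss is read off the new position of the token.  If both players choose
    [a], the tosses cannot be told apart, and [S1] is followed in both cases.
    At stage 0, a history that does not start at [x] leaves the token where it
    is. *)
Definition glue x a S1 S2 : strategy := fun k =>
  if k is j.+1 then fun h : history j.+1 =>
    if `[< (thead h.2).2 = a >] then S1 j (htail h) else S2 j (htail h)
  else fun h : history 0 => if `[< h.1 = x >] then a else h.1.

Lemma measurable_asbool d (T : measurableType d) (f : T -> pt) a :
  measurable_fun [set: T] f -> measurable_fun [set: T] (fun t => `[< f t = a >]).
Proof.
move=> mf; apply: (@measurable_fun_bool _ _ _ _ true).
rewrite setTI (_ : _ @^-1` _ = f @^-1` [set a]).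
  by rewrite -[X in measurable X]setTI; apply: mf => //; exact: measurable_point.
by apply/seteqP; split => t /asboolP.
Qed.

Lemma stay_strategies eps : 0 < eps -> strategies eps stay.
Proof.
move=> eps0 k; split; first exact: measurable_current.
by move=> h; rewrite /eball /= subrr enorm0.
Qed.

Lemma after_strategies eps x a b S : strategies eps S ->
  strategies eps (after x a b S).
Proof.
move=> hS k; case: (hS k.+1) => mS bS; split; last first.
  by move=> h; have := bS (hcons x a b h); rewrite current_hcons.
by apply: (measurableT_comp mS); exact: measurable_hcons.
Qed.

Lemma glue_strategies eps x a S1 S2 : 0 < eps -> eball x eps a ->
  strategies eps S1 -> strategies eps S2 -> strategies eps (glue x a S1 S2).
Proof.
move=> eps0 xa h1 h2 [|k]; split.
- apply: measurable_fun_ifT => //; exact: measurable_asbool.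
- move=> h; rewrite /current (tuple0 h.2) /=; case: asboolP => [->//|_].
  by rewrite /eball /= subrr enorm0.
- apply: measurable_fun_ifT.
  + apply: measurable_asbool; apply: measurableT_comp => //.
    apply: (@measurableT_comp _ _ _ _ _ _ (fun t : k.+1.-tuple _ => thead t)) => //.
    exact: measurable_tnth.
  + by apply: (measurableT_comp (proj1 (h1 k))); exact: measurable_htail.
  + by apply: (measurableT_comp (proj1 (h2 k))); exact: measurable_htail.
- move=> h /=; rewrite -current_htail.
  by case: asboolP => _; [exact: (proj2 (h1 k))|exact: (proj2 (h2 k))].
Qed.

Lemma htail_hcons x a b k (h : history k) : htail (hcons x a b h) = h.
Proof. by case: h => y t; congr pair; apply/val_inj. Qed.

Lemma glue_hcons x a S1 S2 a' b k (h : history k) :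
  @glue x a S1 S2 k.+1 (hcons x a' b h) =
  if `[< h.1 = a >] then S1 k h else S2 k h.
Proof. by rewrite /glue htail_hcons. Qed.

Lemma ptail_pcons x a b (h : play) : ptail (pcons x a b h) = h.
Proof. by case: h. Qed.

Lemma stop_stopping : stopping_rules (fun _ : play => 0%N).
Proof.
move=> [|k]; [exists setT|exists set0] => //; first by rewrite preimage_setT; apply/seteqP; split.
by rewrite preimage_set0; apply/seteqP; split.
Qed.

Definition glue_tau a (t1 t2 : play -> nat) : play -> nat := fun h =>
  (if `[< (h.2 0%N).2 = a >] then t1 (ptail h) else t2 (ptail h)).+1.

Lemma glue_tau_pcons x a t1 t2 a' b (h : play) :
  glue_tau a t1 t2 (pcons x a' b h) = (if `[< h.1 = a >] then t1 h else t2 h).+1.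
Proof. by rewrite /glue_tau ptail_pcons. Qed.

Lemma glue_tau_stopping a t1 t2 : stopping_rules t1 -> stopping_rules t2 ->
  stopping_rules (glue_tau a t1 t2).
Proof.
move=> s1 s2 [|k].
  by exists set0 => //; rewrite preimage_set0; apply/seteqP; split.
have [A1 mA1 E1] := s1 k; have [A2 mA2 E2] := s2 k.
pose B := [set h : history k.+1 | (thead h.2).2 = a].
have mB : measurable B.
  have : measurable_fun [set: history k.+1] (fun h : history k.+1 => (thead h.2).2).
    apply: measurableT_comp => //.
    apply: (@measurableT_comp _ _ _ _ _ _ (fun t : k.+1.-tuple _ => thead t)) => //.
    exact: measurable_tnth.
  by move=> /(_ measurableT _ (measurable_point a)); rewrite setTI.
have mt (A : set (history k)) : measurable A -> measurable (@htail R N k @^-1` A).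
  by move=> mA; rewrite -[X in measurable X]setTI; exact: measurable_htail.
exists ((B `&` @htail R N k @^-1` A1) `|` (~` B `&` @htail R N k @^-1` A2)).
  by apply: measurableU; apply: measurableI => //; [exact: mt|exact: measurableC|exact: mt].
have e1 h : t1 h = k <-> A1 (prefix k h) by have := congr1 (fun X => X h) E1 => /= ->.
have e2 h : t2 h = k <-> A2 (prefix k h) by have := congr1 (fun X => X h) E2 => /= ->.
have eB h : B (prefix k.+1 h) <-> (h.2 0%N).2 = a.
  by rewrite /B /= /thead tnth_map tnth_ord_tuple.
apply/seteqP; split => h.
  rewrite /glue_tau /=; case: asboolP => ha [].
    by move=> /e1 h1; left; rewrite -prefix_ptail; split => //; exact/eB.
  by move=> /e2 h2; right; rewrite -prefix_ptail; split => //; move/eB.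
rewrite /glue_tau /= -prefix_ptail => -[[/eB ha /e1 h1]|[ha /e2 h2]].
  by rewrite asboolT// h1.
by rewrite asboolF ?h2// => hb; apply/ha/eB.
Qed.

(** Where [tau] stops the longer play at stage 0 there is nothing left to stop,
    and the truncated predecessor gives 0. *)
Definition after_tau x a b tau : play -> nat := fun h => (tau (pcons x a b h)).-1.

(** The event of stage 0 merges two events of [tau]; which of them is empty
    depends on [x] alone, as stopping at once is decided by the first point. *)
Lemma after_tau_stopping x a b tau : stopping_rules tau ->
  stopping_rules (after_tau x a b tau).
Proof.
move=> s k.
have pre j : exists2 A : set (history j), measurable A &
    [set h | tau (pcons x a b h) = j.+1] = prefix j @^-1` A.
  have [A mA EA] := s j.+1; exists (@hcons R N x a b j @^-1` A).
    by rewrite -[X in measurable X]setTI; exact: measurable_hcons.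
  have e h : tau h = j.+1 <-> A (prefix j.+1 h).
    by have := congr1 (fun X => X h) EA => /= ->.
  by apply/seteqP; split => h; rewrite /= -prefix_pcons => /e.
case: k => [|k]; last first.
  have [A mA EA] := pre k.+1; exists A => //; rewrite -EA.
  by apply/seteqP; split => h; rewrite /after_tau /=; case: (tau _) => [|[|n]] //= [->].
have [A mA EA] := pre 0%N; have [A0 mA0 EA0] := s 0%N.
have e0 h : tau h = 0%N <-> A0 (prefix 0 h).
  by have := congr1 (fun X => X h) EA0 => /= ->.
have e1 h : tau (pcons x a b h) = 1%N <-> A (prefix 0 h).
  by have := congr1 (fun X => X h) EA => /= ->.
have [x0|nx0] := pselect (A0 (start x)); [exists setT|exists A] => //.
  rewrite preimage_setT; apply/seteqP; split => // h _; rewrite /after_tau /=.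
  suff -> : tau (pcons x a b h) = 0%N by [].
  apply/e0; rewrite (_ : prefix 0 _ = start x)//.
  by congr pair; apply/val_inj; rewrite /= enum_ord0.
apply/seteqP; split => h; rewrite /after_tau /=; last by move=> /e1 ->.
move=> h1; apply/e1; move: h1; case E : (tau _) => [|n] /= => [_|->//].
exfalso; apply: nx0; move/e0: E; rewrite (_ : prefix 0 _ = start x)//.
by congr pair; apply/val_inj; rewrite /= enum_ord0.
Qed.

End gluing.

(** * Dynamic programming *)

Section dynamic_programming.
Context {d : measure_display} {T : measurableType d} {R : realType} {N : nat}.
Local Notation V := 'rV[R]_N.
Variables (P : probability T R) (coin : nat -> {RV P >-> bool}).
Hypothesis fair : fair_coins coin.
Variables (Om Gam : set V) (F Psi : V -> R) (eps : R) (u : V -> R).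
Hypotheses (eps_gt0 : 0 < eps)
  (disj : forall x, Om x -> ~ Gam x)
  (moves : forall x y, Om x -> eball x eps y -> (Om `|` Gam) y)
  (val : game_value coin Gam F Psi eps Om u).
Implicit Types (SI SII : strategy R N) (tau : play R N -> nat) (x : V).

Local Notation gmean tau SI SII x := (mean coin (toss_payoff Gam F Psi tau SI SII x)).
Local Notation VI := (V_I coin Gam F Psi).
Local Notation VII := (V_II coin Gam F Psi).

Lemma terminates_asT tau SI SII x : terminates_as coin Gam tau SI SII x.
Proof. by apply: aeW => w; exact: terminatesT. Qed.

Lemma V_I_mean tau SI SII x : stopping_rules tau ->
  VI tau SI SII x = (gmean tau SI SII x)%:E.
Proof.
move=> st; rewrite /V_I asboolT; last exact: terminates_asT.
exact: (decided_expectation fair (toss_payoff_decided Gam F Psi SI SII x st)).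
Qed.

Lemma V_II_mean tau SI SII x : stopping_rules tau ->
  VII tau SI SII x = (gmean tau SI SII x)%:E.
Proof.
move=> st; rewrite /V_II asboolT; last exact: terminates_asT.
exact: (decided_expectation fair (toss_payoff_decided Gam F Psi SI SII x st)).
Qed.

(** The four lemmas below express that [u] is both values: against a known
    strategy there is a reply that is good up to [e], and conversely there is a
    strategy that guarantees [u] up to [e] against all replies. *)
Lemma value_reply_II x tau SI e : (Om `|` Gam) x -> 0 < e ->
  stopping_rules tau -> strategies eps SI ->
  exists2 SII, strategies eps SII & gmean tau SI SII x < u x + e.
Proof.
move=> ZX e0 st sI; have [uI _] := val ZX.
have : (ereal_inf [set VI tau SI SII x | SII in strategies eps] < (u x + e)%:E)%E.
  apply: (@le_lt_trans _ _ (u x)%:E); last by rewrite lte_fin ltrDl.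
  by rewrite -uI; apply: ereal_sup_ubound; exists tau => //; exists SI.
move=> /ereal_inf_lt[_ [SII sII <-]]; rewrite V_I_mean// lte_fin.
by exists SII.
Qed.

Lemma value_reply_I x SII e : (Om `|` Gam) x -> 0 < e ->
  strategies eps SII ->
  exists tau SI, [/\ stopping_rules tau, strategies eps SI
    & u x - e < gmean tau SI SII x].
Proof.
move=> ZX e0 sII; have [_ uII] := val ZX.
have : ((u x - e)%:E < ereal_sup [set VII tau SI SII x
    | tau in (@stopping_rules R N) & SI in strategies eps])%E.
  apply: (@lt_le_trans _ _ (u x)%:E); first by rewrite lte_fin ltrBlDr ltrDl.
  by rewrite -uII; apply: ereal_inf_lbound; exists SII.
move=> /ereal_sup_gt[_ [tau st [SI sI <-]]]; rewrite V_II_mean// lte_fin.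
by exists tau, SI.
Qed.

Lemma value_guarantee_I x e : (Om `|` Gam) x -> 0 < e ->
  exists tau SI, [/\ stopping_rules tau, strategies eps SI
    & forall SII, strategies eps SII -> u x - e < gmean tau SI SII x].
Proof.
move=> ZX e0; have [uI _] := val ZX.
have : ((u x - e)%:E < u_I coin Gam F Psi eps x)%E.
  by rewrite uI lte_fin ltrBlDr ltrDl.
move=> /ereal_sup_gt[_ [tau st [SI sI <-]]] h; exists tau, SI; split => // SII sII.
rewrite -lte_fin -V_I_mean//; apply: lt_le_trans h _.
by apply: ereal_inf_lbound; exists SII.
Qed.

Lemma value_guarantee_II x e : (Om `|` Gam) x -> 0 < e ->
  exists2 SII, strategies eps SII & forall tau SI,
    stopping_rules tau -> strategies eps SI -> gmean tau SI SII x < u x + e.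
Proof.
move=> ZX e0; have [_ uII] := val ZX.
have : (u_II coin Gam F Psi eps x < (u x + e)%:E)%E by rewrite uII lte_fin ltrDl.
move=> /ereal_inf_lt[_ [SII sII <-]] h; exists SII => // tau SI st sI.
rewrite -lte_fin -V_II_mean//; apply: le_lt_trans h.
by apply: ereal_sup_ubound; exists tau => //; exists SI.
Qed.

Lemma value_final x : Gam x -> u x = F x.
Proof.
move=> Gx; have Zx : (Om `|` Gam) x by right.
have m tau SI SII : gmean tau SI SII x = F x.
  by apply: (mean_eq_cst fair) => c; exact: toss_payoff_final.
apply/eqP; rewrite eq_le; apply/andP; split; apply/ler_addgt0Pr => e e0.
  have [tau [SI [_ _ /(_ (@stay R N))]]] := value_guarantee_I Zx e0.
  by rewrite m ltrBlDr => h; apply/ltW/h/stay_strategies.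
have [SII _ /(_ (fun=> 0%N) (@stay R N))] := value_guarantee_II Zx e0.
rewrite m => h; apply/ltW/h; first exact: stop_stopping.
exact: stay_strategies.
Qed.

Lemma value_ge_obstacle x : Om x -> Psi x <= u x.
Proof.
move=> Ox; have Zx : (Om `|` Gam) x by left.
apply/ler_addgt0Pr => e e0.
have [SII _ /(_ (fun=> 0%N) (@stay R N))] := value_guarantee_II Zx e0.
rewrite (@mean_eq_cst _ _ _ _ _ fair _ (Psi x)).
  by move=> h; apply/ltW/h; [exact: stop_stopping|exact: stay_strategies].
move=> c; rewrite toss_payoff_stop// /payoff asboolF//; exact: disj.
Qed.

Lemma mean_first_round tau ta tb SI SII SIa SIIa SIb SIIb x :
  let a := SI 0%N (start x) in let b := SII 0%N (start x) in
  stopping_rules tau -> Om x ->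
  (forall k (h : history R N k), h.1 = a -> SI k.+1 (hcons x a b h) = SIa k h) ->
  (forall k (h : history R N k), h.1 = a -> SII k.+1 (hcons x a b h) = SIIa k h) ->
  (forall h : play R N, h.1 = a -> tau (pcons x a b h) = (ta h).+1) ->
  (forall k (h : history R N k), h.1 = b -> SI k.+1 (hcons x a b h) = SIb k h) ->
  (forall k (h : history R N k), h.1 = b -> SII k.+1 (hcons x a b h) = SIIb k h) ->
  (forall h : play R N, h.1 = b -> tau (pcons x a b h) = (tb h).+1) ->
  gmean tau SI SII x = (gmean ta SIa SIIa a + gmean tb SIb SIIb b) / 2.
Proof.
move=> a b st Ox ha1 ha2 ha3 hb1 hb2 hb3.
rewrite (mean_first_toss fair); last exact: toss_payoff_decided.
have -> : toss_payoff Gam F Psi tau SI SII x \o ccons true =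
    toss_payoff Gam F Psi ta SIa SIIa a.
  apply/funext => c.
  exact: (@toss_payoff_ccons _ _ _ _ _ _ _ _ _ _ _ _ true c (disj Ox)).
have -> // : toss_payoff Gam F Psi tau SI SII x \o ccons false =
  toss_payoff Gam F Psi tb SIb SIIb b.
apply/funext => c.
exact: (@toss_payoff_ccons _ _ _ _ _ _ _ _ _ _ _ _ false c (disj Ox)).
Qed.

(** Whatever near-optimal strategy Player II uses, its first move [b] is known
    to Player I, who can then pick any first move and near-optimal replies from
    the two points the token may reach. *)
Lemma value_super x e : Om x -> 0 < e -> exists2 b, eball x eps b &
  forall a, eball x eps a -> (u a + u b) / 2 <= u x + e.
Proof.
move=> Ox e0; have Zx : (Om `|` Gam) x by left.
have e2 : 0 < e / 2 by lra.
have [SII sII hII] := value_guarantee_II Zx e2.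
pose b := SII 0%N (start x).
have xb : eball x eps b by exact: (proj2 (sII 0%N) (start x)).
exists b => // a xa.
pose SII' := after x a b SII.
have sII' : strategies eps SII' by exact: after_strategies.
have reply y : eball x eps y -> exists r : (play R N -> nat) * strategy R N,
    [/\ stopping_rules r.1, strategies eps r.2 & u y - e / 2 < gmean r.1 r.2 SII' y].
  move=> xy; have [tau [SI h]] := value_reply_I (moves Ox xy) e2 sII'.
  by exists (tau, SI).
have [ra [sa1 sa2 ga]] := reply a xa.
have [rb [sb1 sb2 gb]] : exists r : (play R N -> nat) * strategy R N,
    [/\ stopping_rules r.1, strategies eps r.2 & u b - e / 2 < gmean r.1 r.2 SII' b]
  by exact: reply.
(* [glue] follows the first strategy after both tosses when b = a *)
pose rb' := if `[< b = a >] then ra else rb.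
have [sb1' sb2' gb'] : [/\ stopping_rules rb'.1, strategies eps rb'.2
    & u b - e / 2 < gmean rb'.1 rb'.2 SII' b].
  by rewrite /rb'; case: asboolP => [->|].
pose SI := glue x a ra.2 rb'.2; pose tau := glue_tau a ra.1 rb'.1.
have sI : strategies eps SI by exact: glue_strategies.
have st : stopping_rules tau by exact: glue_tau_stopping.
have SI0 : SI 0%N (start x) = a by rewrite /SI /= asboolT.
have := hII tau SI st sI.
rewrite (@mean_first_round tau ra.1 rb'.1 SI SII ra.2 SII' rb'.2 SII')//; last 6 first.
- by rewrite SI0 => k h ha; rewrite /SI glue_hcons asboolT.
- by rewrite SI0.
- by rewrite SI0 => h ha; rewrite /tau glue_tau_pcons asboolT.
- rewrite SI0 => k h hb; rewrite /SI glue_hcons hb /rb'.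
  by case: asboolP.
- by rewrite SI0.
- by rewrite SI0 => h hb; rewrite /tau glue_tau_pcons hb /rb'; case: asboolP.
by rewrite SI0 -/b; lra.
Qed.

(** If Player I has a near-optimal strategy with payoff above the obstacle, it
    does not stop at once, and its first move is known to Player II. *)
Lemma value_sub x e : Om x -> Psi x < u x -> 0 < e -> exists2 a, eball x eps a &
  forall b, eball x eps b -> u x <= (u a + u b) / 2 + e.
Proof.
move=> Ox Px e0; have Zx : (Om `|` Gam) x by left.
pose e' := Num.min (e / 2) (u x - Psi x).
have e'0 : 0 < e' by rewrite lt_min subr_gt0 Px andbT; lra.
have e'e : e' <= e / 2 by rewrite /e' ge_min lexx.
have e'P : e' <= u x - Psi x by rewrite /e' ge_min lexx orbT.
have [tau [SI [st sI hI]]] := value_guarantee_I Zx e'0.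
pose a := SI 0%N (start x).
have xa : eball x eps a by exact: (proj2 (sI 0%N) (start x)).
have prefix0 (h : play R N) : h.1 = x -> Defs.prefix 0 h = start x.
  by move=> hx; congr pair => //; apply/val_inj; rewrite /= enum_ord0.
have tau_pos (h : play R N) : h.1 = x -> tau h = (tau h).-1.+1.
  move=> hx; case E : (tau h) => //; exfalso.
  have := hI (@stay R N) (@stay_strategies R N _ eps_gt0).
  rewrite (@mean_eq_cst _ _ _ _ _ fair _ (Psi x)); first lra.
  move=> c; rewrite toss_payoff_stop.
    by rewrite /payoff asboolF//; exact: disj.
  by apply: (stopping_prefix st _ E); rewrite !prefix0.
exists a => // b xb.
pose SI' := after x a b SI; pose tau' := after_tau x a b tau.
have sI' : strategies eps SI' by exact: after_strategies.
have st' : stopping_rules tau' by exact: after_tau_stopping.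
have e2 : 0 < e / 2 by lra.
have reply y : eball x eps y ->
    exists2 S, strategies eps S & gmean tau' SI' S y < u y + e / 2.
  by move=> xy; exact: (value_reply_II (moves Ox xy)).
have [Sb sb gb] := reply b xb.
have [Sa sa ga] : exists2 S, strategies eps S & gmean tau' SI' S a < u a + e / 2
  by exact: reply.
pose Sa' := if `[< a = b >] then Sb else Sa.
have [sa' ga'] : strategies eps Sa' /\ gmean tau' SI' Sa' a < u a + e / 2.
  by rewrite /Sa'; case: asboolP => [->|].
pose SII := glue x b Sb Sa'.
have sII : strategies eps SII by exact: glue_strategies.
have SII0 : SII 0%N (start x) = b by rewrite /SII /= asboolT.
have := hI SII sII.
rewrite (@mean_first_round tau tau' tau' SI SII SI' Sa' SI' Sb)//; last 6 first.
- by rewrite SII0.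
- by rewrite SII0 => k h ha; rewrite /SII glue_hcons ha /Sa'; case: asboolP.
- by rewrite SII0 => h _; rewrite tau_pos.
- by rewrite SII0.
- by rewrite SII0 => k h hb; rewrite /SII glue_hcons asboolT.
- by rewrite SII0 => h _; rewrite tau_pos.
by rewrite SII0 -/a; lra.
Qed.

Lemma position_stays tau SI SII x c k : strategies eps SI -> strategies eps SII ->
  (Om `|` Gam) x -> let h := outcome SI SII x c in
  (forall j, (j < k)%N -> ~ ended Gam tau h j) -> (Om `|` Gam) (position h k).
Proof.
move=> sI sII Zx h; elim: k => [//|k IH] ns.
have [Ok|Gk] : (Om `|` Gam) (position h k).
- by apply: IH => j jk; apply: ns; exact: ltnW.
- apply: (moves Ok); rewrite position_prefix prefix_outcome /= /next_round.
  by case: (c k); [exact: (proj2 (sI k))|exact: (proj2 (sII k))].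
- by case: (ns k) => //; left.
Qed.

Lemma value_bounded C : (forall x, (Om `|` Gam) x -> `|payoff Gam F Psi x| <= C) ->
  forall x, (Om `|` Gam) x -> `|u x| <= C.
Proof.
move=> hC x Zx.
have bnd tau SI SII c : strategies eps SI -> strategies eps SII ->
    `|toss_payoff Gam F Psi tau SI SII x c| <= C.
  move=> sI sII; apply: hC; apply: position_stays => //.
  exact: (proj2 (end_stageP _ _ _)).
rewrite ler_norml; apply/andP; split; apply/ler_addgt0Pr => e e0.
  have [SII sII /(_ (fun=> 0%N) (@stay R N))h] := value_guarantee_II Zx e0.
  apply/ltW; apply: le_lt_trans (h (@stop_stopping R N) (@stay_strategies R N _ eps_gt0)).
  apply: (mean_ge fair); first exact/toss_payoff_decided/stop_stopping.
  move=> c; have := bnd (fun=> 0%N) _ _ c (@stay_strategies R N _ eps_gt0) sII.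
  by rewrite ler_norml => /andP[].
have [tau [SI [st sI /(_ (@stay R N) (@stay_strategies R N _ eps_gt0))]]] := value_guarantee_I Zx e0.
rewrite ltrBlDr => h; apply/ltW/(lt_le_trans h); rewrite lerD2r.
apply: (mean_le fair); first exact: toss_payoff_decided.
move=> c; have := bnd tau _ _ c sI (@stay_strategies R N _ eps_gt0).
by rewrite ler_norml => /andP[].
Qed.

End dynamic_programming.

(** * Comparison with cones for the game *)

Section discrete_cones.
Context {R : realType} {N : nat}.
Local Notation V := 'rV[R]_N.
Implicit Types (x y z p q : V) (A : set V) (a b eps e L : R) (u : V -> R).

(** The inequality [u y <= (sup u + inf u) / 2] over the ball around [y], written
    without suprema: [p] nearly attains the supremum. *)
Definition discrete_sub eps u y := forall e, 0 < e ->
  exists2 p, eball y eps p &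
    forall q, eball y eps q -> u y <= (u p + u q) / 2 + e.

(** The comparison function is [a + J + g (|y - x|)] with [g t = b t - c t^2].
    At distance at least [eps] from the vertex its average over the best and the
    worst moves falls short of its value by exactly [c eps^2].  Closer to the
    vertex one may move to the vertex itself, where the function that is
    compared lies below [a]: the jump [J] pays for the other move.  So a nearly
    largest positive difference is impossible. *)
Lemma discrete_cone_strict eps b0 b a r C A x u :
  0 < eps -> 0 <= b0 < b -> (forall y, A y -> enorm (y - x) <= r) ->
  (forall y, A y -> u y <= C) -> ~ A x ->
  (forall y, A y -> a + b0 * enorm (y - x) < u y -> discrete_sub eps u y) ->
  (forall y z, A y -> eball y eps z -> ~ A z -> u z <= a + b0 * enorm (z - x)) ->
  forall y, A y -> u y <= a + b * enorm (y - x) + 3 * b * eps.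
Proof.
move=> eps0 /andP[b00 b0b] Ar AC nAx sub nbh y0 Ay0; rewrite leNgt; apply/negP => bad.
have r0 : 0 <= r by apply: le_trans (Ar _ Ay0); exact: enorm_ge0.
pose M := r + eps; have M0 : 0 < M by rewrite /M; lra.
pose c := (b - b0) / (4 * M).
have c0 : 0 < c by rewrite divr_gt0 ?subr_gt0// mulr_gt0.
have cM : c * (4 * M) = b - b0 by rewrite mulfVK// gt_eqF// mulr_gt0.
pose J := 3 * b * eps.
have b_gt0 : 0 < b by lra.
have J0 : 0 < J by rewrite !mulr_gt0.
pose g t := b * t - c * t ^+ 2.
have ctM t : 0 <= t <= M -> c * t * 4 <= b - b0.
  move=> /andP[t0 tM]; rewrite -cM.
  by have := ler_wpM2l (ltW c0) tM; lra.
have g_mono s t : 0 <= s -> s <= t -> t <= M -> g s <= g t.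
  move=> s0 st tM; rewrite -subr_ge0.
  have -> : g t - g s = (t - s) * (b - c * s - c * t) by rewrite /g; ring.
  rewrite mulr_ge0 ?subr_ge0//.
  have := @ctM s; have := @ctM t; rewrite s0 tM (le_trans st tM) (le_trans s0 st) => /(_ isT) + /(_ isT).
  by lra.
have g_ge t : 0 <= t -> t <= M -> b0 * t <= g t.
  move=> t0 tM; have := @ctM t; rewrite t0 tM => /(_ isT) h.
  rewrite -subr_ge0; have -> : g t - b0 * t = t * (b - b0 - c * t) by rewrite /g; ring.
  by apply: mulr_ge0 => //; have := mulr_ge0 (ltW c0) t0; lra.
have g_le t : 0 <= t -> g t <= b * t.
  by move=> t0; rewrite /g gerBl mulr_ge0 ?sqr_ge0// ltW.
pose phi y := a + J + g (enorm (y - x)).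
pose S := [set u y - phi y | y in A].
have g_ge0 y : A y -> 0 <= g (enorm (y - x)).
  move=> Ay; apply: le_trans (g_ge _ (enorm_ge0 _) _).
    by rewrite mulr_ge0 ?enorm_ge0.
  by rewrite (le_trans (Ar _ Ay))// /M lerDl ltW.
have supS : has_sup S.
  split; first by exists (u y0 - phi y0), y0.
  exists (C - a - J) => _ [y Ay <-]; rewrite /phi.
  by have := AC y Ay; have := g_ge0 y Ay; lra.
pose s := sup S.
have ub y : A y -> u y <= phi y + s.
  by move=> Ay; rewrite -lerBlDl; apply: sup_upper_bound => //; exists y.
have s0 : 0 < s.
  apply: (@lt_le_trans _ _ (u y0 - phi y0)).
    rewrite subr_gt0 /phi; apply: le_lt_trans bad.
    by have := g_le _ (enorm_ge0 (y0 - x)); rewrite /J; lra.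
  by apply: sup_upper_bound => //; exists y0.
pose sg := Num.min (s / 2) (Num.min (b * eps / 8) (c * eps ^+ 2 / 8)).
have ce0 : 0 < c * eps ^+ 2 by rewrite mulr_gt0 ?exprn_gt0.
have be0 : 0 < b * eps by rewrite mulr_gt0.
have sg0 : 0 < sg by rewrite !lt_min; apply/and3P; split; lra.
have sg1 : sg <= s / 2 by rewrite ge_min lexx.
have sg2 : sg <= b * eps / 8 by rewrite !ge_min lexx orbT.
have sg3 : sg <= c * eps ^+ 2 / 8 by rewrite !ge_min lexx !orbT.
have [_ [y Ay <-] hy] := sup_adherent sg0 supS; rewrite -/s in hy.
pose rho := enorm (y - x).
have rho_r : rho <= r by exact: Ar.
have rho0 : 0 < rho.
  by rewrite enorm_gt0 subr_eq0; apply/eqP => yx; apply: nAx; rewrite -yx.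
have uy : a + b0 * rho < u y.
  have := g_ge _ (ltW rho0); have rM : rho <= M by rewrite /M; lra.
  by move=> /(_ rM); rewrite /phi -/rho in hy; lra.
have [p yp hp] := sub y Ay uy _ sg0.
have all z : eball y eps z -> u z <= a + J + g (enorm (z - x)) + s.
  move=> yz; have [Az|nAz] := pselect (A z); first exact: ub.
  have zM : enorm (z - x) <= M.
    have := enorm_triangle y z x; have : enorm (z - y) < eps by [].
    by rewrite /M -/rho; lra.
  have := nbh _ _ Ay yz nAz; have := g_ge _ (enorm_ge0 _) zM.
  by lra.
have up : u p <= a + J + g (rho + eps) + s.
  apply: le_trans (all _ yp) _; rewrite lerD2r lerD2l.
  apply: g_mono; [exact: enorm_ge0| |by rewrite /M; lra].
  have := enorm_triangle y p x; have : enorm (p - y) < eps by [].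
  by rewrite -/rho; lra.
rewrite /phi -/rho in hy.
(* close to the vertex: move to the vertex *)
have [rho_eps|eps_rho] := ltP rho eps.
  have yx : eball y eps x by rewrite /eball /= enormB.
  have := hp x yx; have := nbh _ _ Ay yx nAx; rewrite subrr enorm0 mulr0 addr0.
  have := g_le (rho + eps); have := g_ge0 y Ay; rewrite -/rho.
  have := ltW be0.
  have : b * (rho + eps) <= b * (2 * eps) by rewrite ler_pM2l//; lra.
  have rr : 0 <= rho + eps by lra.
  rewrite /J => h1 h2 h3 /(_ rr); rewrite /J in up hy.
  by lra.
(* away from the vertex: move towards it, almost as far as allowed, since the
   ball of moves is open; t is the distance that is lost *)
pose t := Num.min (eps / 2) (c * eps ^+ 2 / (2 * b)).
have t0 : 0 < t by rewrite lt_min; apply/andP; split; [lra|rewrite divr_gt0//; lra].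
have t1 : t <= eps / 2 by rewrite ge_min lexx.
have t2 : b * t * 2 <= c * eps ^+ 2.
  have : t <= c * eps ^+ 2 / (2 * b) by rewrite ge_min lexx orbT.
  by rewrite ler_pdivlMr; lra.
pose q := y - ((eps - t) / rho) *: (y - x).
have yq : eball y eps q.
  rewrite /eball /= /q addrAC subrr add0r enormN enormZ -/rho.
  rewrite ger0_norm ?divr_ge0 ?ltW//; last lra.
  by rewrite mulfVK ?gt_eqF//; lra.
have qx : enorm (q - x) = rho - eps + t.
  have -> : q - x = (1 - (eps - t) / rho) *: (y - x).
    by rewrite scalerBl scale1r /q addrAC.
  have e1 : 0 <= 1 - (eps - t) / rho.
    by rewrite subr_ge0 ler_pdivrMr// mul1r; lra.
  rewrite enormZ -/rho ger0_norm// mulrBl mul1r mulfVK ?gt_eqF//; lra.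
have := hp q yq; have := all q yq; rewrite qx.
have : g (rho - eps + t) <= g (rho - eps) + b * t.
  rewrite -subr_ge0.
  have -> : g (rho - eps) + b * t - g (rho - eps + t) =
    c * t * (2 * (rho - eps) + t) by rewrite /g; ring.
  by apply: mulr_ge0; [rewrite mulr_ge0 ?ltW|lra].
have : g (rho - eps) + g (rho + eps) = 2 * g rho - 2 * (c * eps ^+ 2) by rewrite /g; ring.
by lra.
Qed.

Lemma discrete_cone eps b a r C A x u :
  0 < eps -> 0 <= b -> (forall y, A y -> enorm (y - x) <= r) ->
  (forall y, A y -> u y <= C) -> ~ A x ->
  (forall y, A y -> a + b * enorm (y - x) < u y -> discrete_sub eps u y) ->
  (forall y z, A y -> eball y eps z -> ~ A z -> u z <= a + b * enorm (z - x)) ->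
  forall y, A y -> u y <= a + b * enorm (y - x) + 3 * b * eps.
Proof.
move=> eps0 b0 Ar AC nAx sub nbh y Ay; apply/ler_addgt0Pr => e e0.
pose k := enorm (y - x) + 3 * eps.
have k0 : 0 < k by have := enorm_ge0 (y - x); rewrite /k; lra.
pose b' := b + e / k.
have ek : 0 < e / k by rewrite divr_gt0.
have bb : 0 <= b < b' by rewrite b0 /b'; lra.
apply: le_trans (discrete_cone_strict eps0 bb Ar AC nAx sub nbh Ay) _.
have : e / k * k = e by rewrite mulfVK// gt_eqF.
by rewrite /b' {2}/k; lra.
Qed.

Section discrete_lipschitz.
Variables (Om Gam : set V) (F Psi : V -> R) (eps L C : R).
Hypotheses (eps0 : 0 < eps) (L0 : 0 <= L) (bOm : bounded_set Om)
  (disj : forall x, Om x -> ~ Gam x)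
  (moves : forall x y, Om x -> eball x eps y -> (Om `|` Gam) y).

Lemma bounded_radius x : exists r, forall y, Om y -> enorm (y - x) <= r.
Proof.
have /bounded_enormP[M hM] := bOm; exists (M + enorm x) => y /hM yM.
by apply: le_trans (enormD _ _) _; rewrite enormN lerD2r.
Qed.

Lemma discrete_from_boundary (w : V -> R) z : elip L Gam w ->
  (forall y, Om y -> w y <= C) -> Gam z ->
  (forall y, Om y -> w z + L * enorm (y - z) < w y -> discrete_sub eps w y) ->
  forall y, Om y -> w y <= w z + L * enorm (y - z) + 3 * L * eps.
Proof.
move=> lw wC Gz sub; have [r hr] := bounded_radius z.
apply: (discrete_cone eps0 L0 hr wC _ sub); first by move=> /disj.
move=> y t Oy yt nOt; rewrite -lerBlDl; apply: lw => //.
by case: (moves Oy yt).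
Qed.

(** First the vertex is put on the strip, for [u] and for [- u].  The bounds so
    obtained are the boundary values needed for a vertex in the domain.  Cones of
    slope [L] through points above the obstacle stay above the obstacle. *)
Lemma discrete_lipschitz (u : V -> R) : elip L Gam F -> elip L setT Psi ->
  (forall x, Gam x -> Psi x <= F x) -> (forall x, Gam x -> u x = F x) ->
  (forall x, Om x -> Psi x <= u x) ->
  (forall x, Om x -> Psi x < u x -> discrete_sub eps u x) ->
  (forall x, Om x -> discrete_sub eps (\- u) x) ->
  (forall x, Om x -> `|u x| <= C) ->
  forall x y, (Om `|` Gam) x -> (Om `|` Gam) y ->
    u y - u x <= L * enorm (y - x) + 6 * L * eps.
Proof.
move=> lF lPsi PF uF Pu sub super uC.
have luG : elip L Gam u by move=> x y Gx Gy; rewrite !uF//; exact: lF.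
have uC1 y : Om y -> u y <= C by move=> /uC; rewrite ler_norml => /andP[].
have uC2 y : Om y -> - u y <= C by move=> /uC; rewrite ler_norml lerNl => /andP[].
have Psi_cone x y : Psi x <= u x -> Psi y <= u x + L * enorm (y - x).
  by move=> h; have := lPsi x y I I; lra.
have Le : 0 <= L * eps by rewrite mulr_ge0// ltW.
have up z y : Gam z -> Om y -> u y <= u z + L * enorm (y - z) + 3 * L * eps.
  move=> Gz; apply: discrete_from_boundary => // t Ot ht.
  apply: sub => //; apply: le_lt_trans ht; apply: Psi_cone.
  by rewrite uF//; exact: PF.
have low z y : Gam z -> Om y -> u z <= u y + L * enorm (y - z) + 3 * L * eps.
  move=> Gz Oy; have := @discrete_from_boundary (\- u) z (elipN luG) uC2 Gz.
  by move=> /(_ (fun t Ot _ => super t Ot) y Oy) /=; lra.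
move=> x y [Ox|Gx] [Oy|Gy]; last first.
- by have := luG x y Gx Gy; lra.
- by have := up x y Gx Oy; lra.
- by have := low y x Gy Ox; rewrite enormB; lra.
have [->|yx] := eqVneq y x.
  by rewrite !subrr enorm0; lra.
have [r hr] := bounded_radius x.
have h : forall z, (Om `\ x) z -> u z <= (u x + 3 * L * eps) + L * enorm (z - x) + 3 * L * eps.
  apply: (@discrete_cone eps L _ r C) => //.
  - by move=> z [/hr].
  - by move=> z [/uC1].
  - by move=> [_ /(_ erefl)].
  - move=> z [Oz _] hz; apply: sub => //; apply: le_lt_trans hz.
    by have := Psi_cone x z (Pu x Ox); lra.
  move=> z t [Oz _] zt nt; have [Ot|Gt] := moves Oz zt; last first.
    by have := low t x Gt Ox; rewrite enormB; lra.
  have -> : t = x by apply: contrapT => tx; apply: nt.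
  by rewrite subrr enorm0; lra.
have /h : (Om `\ x) y by split => //= e; rewrite e eqxx in yx.
by lra.
Qed.

End discrete_lipschitz.
End discrete_cones.

(** * Comparison with cones implies uniqueness *)

Section comparison.
Context {R : realType} {N : nat}.
Local Notation V := 'rV[R]_N.
Implicit Types (x y z p q : V) (A Om : set V) (a b r e L M : R) (w : V -> R).

(** The obstacle [O] takes values in the extended reals so that [-oo] stands for
    its absence. *)
Definition cone_above Om (O : V -> \bar R) w :=
  forall A x a b, open A -> A `<=` Om -> ~ A x -> 0 <= b ->
    (forall y, A y -> (O y <= (a + b * enorm (y - x))%:E)%E) ->
    (forall y, closure A y -> ~ A y -> w y <= a + b * enorm (y - x)) ->
    forall y, A y -> w y <= a + b * enorm (y - x).

Lemma enorm_delta i : enorm (delta_mx 0 i : V) = 1.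
Proof.
rewrite /enorm /dotv (bigD1 i)//= big1 ?addr0; first by rewrite !mxE !eqxx mulr1 sqrtr1.
by move=> j /negPf ji; rewrite !mxE ji andbF mulr0.
Qed.

Lemma open_annulus x r : open [set y : V | 0 < enorm (y - x) < r].
Proof.
apply/open_enormP => y /= /andP[y0 yr].
exists (Num.min (enorm (y - x)) (r - enorm (y - x))).
  by rewrite lt_min y0 subr_gt0.
move=> z; rewrite lt_min => /andP[z1 z2].
have := enorm_triangle z y x; rewrite (enormB y z).
have := enorm_triangle y z x.
by move=> h1 h2; apply/andP; split; lra.
Qed.

(** Comparison on the punctured ball with the cone that takes the value [w x] at
    its vertex [x] and the value [M] at distance [2 r]. *)
Lemma cone_midpoint Om O w x r M : cone_above Om O w -> 0 < r ->
  (forall y, enorm (y - x) <= 2 * r -> Om y) ->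
  (forall y, enorm (y - x) <= 2 * r -> w y <= M) ->
  (forall y, enorm (y - x) <= 2 * r -> (O y <= (w x)%:E)%E) ->
  forall y, enorm (y - x) <= r -> w y <= (w x + M) / 2.
Proof.
move=> cw r0 hOm hM hO y yr.
have wM : w x <= M by apply: hM; rewrite subrr enorm0; lra.
have [->|yx] := eqVneq y x; first lra.
pose b := (M - w x) / (2 * r).
have r2 : 0 < 2 * r by lra.
have b0 : 0 <= b by rewrite divr_ge0 ?subr_ge0// ltW.
have br : b * (2 * r) = M - w x by rewrite mulfVK// gt_eqF.
have /(_ y) : forall y, [set y : V | 0 < enorm (y - x) < 2 * r] y -> w y <= w x + b * enorm (y - x).
  apply: cw => //.
  - exact: open_annulus.
  - by move=> z /= /andP[_ /ltW]; exact: hOm.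
  - by rewrite /= subrr enorm0 ltxx.
  - move=> z /= /andP[_ /ltW /hO h]; apply: le_trans h _.
    by rewrite lee_fin lerDl mulr_ge0 ?enorm_ge0.
  - move=> z /closure_enormP cz nz.
    have [->|zx] := eqVneq z x; first by rewrite subrr enorm0 mulr0 addr0.
    have z2r : enorm (z - x) <= 2 * r.
      apply/ler_addgt0Pr => e /cz[t /= /andP[_ tr] tz].
      by have := enorm_triangle t z x; rewrite (enormB z t); lra.
    have -> : enorm (z - x) = 2 * r.
      apply/eqP; rewrite eq_le z2r leNgt; apply/negP => zr.
      by apply: nz => /=; rewrite zr enorm_gt0 subr_eq0 zx.
    by rewrite br; have := hM z z2r; lra.
have -> /= : [set y : V | 0 < enorm (y - x) < 2 * r] y = True.
  apply/propext; split => // _ /=.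
  by rewrite enorm_gt0 subr_eq0 yx/=; lra.
move=> /(_ Logic.I) h; apply: le_trans h _.
by have := ler_wpM2l b0 yr; lra.
Qed.

Definition is_ball_max r w U := forall x,
  (exists2 z, enorm (z - x) <= r & U x = w z) /\
  forall z, enorm (z - x) <= r -> w z <= U x.

Lemma ball_max_exists r L w : 0 <= r -> 0 <= L -> elip L setT w ->
  exists2 U, is_ball_max r w U & elip L setT U.
Proof.
move=> r0 L0 lw.
have ex x : exists z, enorm (z - x) <= r /\ forall t, enorm (t - x) <= r -> w t <= w z.
  have [||z zr hz] := @max_on_compact _ _ _ w _ (@compact_enorm_ball R N x r).
  - by exists x => /=; rewrite subrr enorm0.
  - by apply: continuous_subspaceT; exact: elip_continuous lw.
  by exists z.
have [f hf] := choice ex.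
exists (fun x => w (f x)).
  by move=> x; have [h1 h2] := hf x; split => //; exists (f x).
move=> x y _ _; have [fy _] := hf y; have [_ fx] := hf x.
have := fx (f y + (x - y)).
have -> : f y + (x - y) - x = f y - y by rewrite addrAC addrA subrK.
move=> /(_ fy); have := lw (f y + (x - y)) (f y) I I.
have -> : f y - (f y + (x - y)) = y - x by rewrite opprD addrA subrr add0r opprB.
by lra.
Qed.

(** Armstrong and Smart: the value [U x] is attained within distance [r] of [x],
    hence at most the mean of [w x], which is below [U] on the ball, and of the
    maximum of [w] over the double ball, which [U] reaches half-way to the point
    where it is attained. *)
Lemma ball_max_sub Om O w x r L U : cone_above Om O w -> 0 < r -> 0 <= L ->
  elip L setT w -> is_ball_max r w U ->
  (forall y, enorm (y - x) <= 2 * r -> Om y) ->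
  (forall y, enorm (y - x) <= 2 * r -> (O y <= (w x)%:E)%E) ->
  exists2 z, enorm (z - x) <= r &
    forall y, enorm (y - x) <= r -> 2 * U x <= U y + U z.
Proof.
move=> cw r0 L0 lw bU hOm hO.
have [||z zr hz] := @max_on_compact _ _ _ w _ (@compact_enorm_ball R N x (2 * r)).
- by exists x => /=; rewrite subrr enorm0; lra.
- by apply: continuous_subspaceT; exact: elip_continuous lw.
have half (v : V) : enorm (2^-1 *: v) = enorm v / 2.
  by rewrite enormZ ger0_norm ?invr_ge0// mulrC.
exists (x + 2^-1 *: (z - x)).
  by rewrite addrAC subrr add0r half; move: zr => /=; lra.
move=> y yr; have [[t tr ->] _] := bU x.
have := cone_midpoint cw r0 hOm hz hO tr.
have [_ /(_ x)] := bU y; rewrite enormB => /(_ yr).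
have [_ /(_ z)] := bU (x + 2^-1 *: (z - x)).
have -> : z - (x + 2^-1 *: (z - x)) = 2^-1 *: (z - x).
  rewrite opprD addrA -{1}(scale1r (z - x)) -scalerBl.
  by congr (_ *: _); lra.
by rewrite half; move: zr => /= zr /(_ ltac:(lra)); lra.
Qed.

(** The point [x0] maximises [U + W] over the closed domain, among such points it
    maximises [U], and among the remaining ones a coordinate.  Near [x0] the gap
    between [w1] and [w2] keeps the balls inside the domain and [w1] above the
    obstacle, so that [ball_max_sub] applies to [w1] and to [- w2] at [x0]. *)
Lemma cone_comparison Om (Psi w1 w2 : V -> R) L rho : (0 < N)%N ->
  open Om -> bounded_set Om -> 0 <= L -> 0 < rho ->
  elip L setT Psi -> elip L setT w1 -> elip L setT w2 ->
  cone_above Om (EFin \o Psi) w1 -> cone_above Om (fun=> -oo%E) (\- w2) ->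
  (forall x, Om x -> Psi x <= w2 x) ->
  (forall x y, closure Om x -> ~ Om y -> enorm (y - x) <= rho -> w1 y <= w2 y) ->
  forall x, Om x -> w1 x <= w2 x.
Proof.
move=> N0 oOm bOm L0 rho0 lP l1 l2 c1 c2 Pw out p Op; rewrite leNgt; apply/negP => bad.
pose m := w1 p - w2 p; have m0 : 0 < m by rewrite subr_gt0.
have L1 : 0 < 8 * (L + 1) by rewrite mulr_gt0// ltr_wpDl.
pose r := Num.min (rho / 2) (m / (8 * (L + 1))).
have r0 : 0 < r by rewrite lt_min !divr_gt0.
have r_rho : 2 * r <= rho.
  by have : r <= rho / 2; [rewrite ge_min lexx|lra].
have rm : 8 * (L * r) < m.
  have : r <= m / (8 * (L + 1)) by rewrite ge_min lexx orbT.
  by rewrite ler_pdivlMr//; lra.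
have [U bU lU] := ball_max_exists (ltW r0) L0 l1.
have [W bW lW] := ball_max_exists (ltW r0) L0 (elipN l2).
have cU := elip_continuous L0 lU; have cW := elip_continuous L0 lW.
pose D x := U x + W x.
have cD : continuous D by move=> x; apply: continuousD; [exact: cU|exact: cW].
have cK : compact (closure Om).
  apply: bounded_closed_compact; last exact: closed_closure.
  have /bounded_enormP[M hM] := bOm; apply/bounded_enormP; exists (M + 1) => x /closure_enormP/(_ 1 ltr01)[y /hM yM yx].
  by have := enorm_triangle y x 0; rewrite !subr0 (enormB x y); lra.
have K0 : closure Om !=set0 by exists p; exact: subset_closure.
have [B1 [B1n cB1 B1K B1P]] := compact_argmax K0 cK cD.
have [B2 [B2n cB2 B2B1 B2P]] := compact_argmax B1n cB1 cU.
pose i0 : 'I_N := Ordinal N0.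
have cc : continuous (fun x : V => x 0 i0) by move=> x; exact: coord_continuous.
have [B3 [[x0 B3x0] _ _ /(_ x0)[B3P _]]] := compact_argmax B2n cB2 cc.
have {B3P B3x0} [B2x0 maxc] := B3P B3x0.
have [B1x0 maxU] := (B2P x0).1 B2x0.
have [Kx0 maxD] := (B1P x0).1 B1x0.
have nearU x : U x <= w1 x + L * r.
  have [[z zr ->] _] := bU x; have := l1 x z I I.
  by have := ler_wpM2l L0 zr; lra.
have nearW x : W x <= - w2 x + L * r.
  have [[z zr Wz] _] := bW x; have {}Wz : W x = - w2 z by rewrite Wz.
  have xz : enorm (x - z) <= r by rewrite enormB.
  by have := l2 z x I I; have := ler_wpM2l L0 xz; rewrite Wz; lra.
have Dp : m <= D p.
  have [_ /(_ p)] := bU p; have [_ /(_ p)] := bW p.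
  by rewrite subrr enorm0 /D /m /= => /(_ (ltW r0)) + /(_ (ltW r0)); lra.
have gap : m - 2 * (L * r) <= w1 x0 - w2 x0.
  have := maxD p (subset_closure Op); have := nearU x0; have := nearW x0.
  by rewrite {1 2}/D; rewrite /D in Dp; lra.
have Lr : 0 <= L * r by rewrite mulr_ge0// ltW.
have inside y : enorm (y - x0) <= 2 * r -> Om y.
  move=> yr; apply: contrapT => nOy.
  have := out x0 y Kx0 nOy (le_trans yr r_rho).
  have := l1 y x0 I I; have := l2 x0 y I I; rewrite (enormB x0 y).
  by have := ler_wpM2l L0 yr; lra.
have Ox0 : Om x0 by apply: inside; rewrite subrr enorm0; lra.
have Psi_low y : enorm (y - x0) <= 2 * r -> ((EFin \o Psi) y <= (w1 x0)%:E)%E.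
  move=> yr; rewrite lee_fin; have := lP x0 y I I; have := Pw x0 Ox0.
  by have := ler_wpM2l L0 yr; lra.
have [z zr hz] := ball_max_sub c1 r0 L0 l1 bU inside Psi_low.
have [t tr ht] := ball_max_sub c2 r0 L0 (elipN l2) bW inside (fun _ _ => leNye _).
have in_ball y : enorm (y - x0) <= r -> closure Om y.
  by move=> yr; apply/subset_closure/inside; lra.
have Dz := maxD z (in_ball z zr); have Dt := maxD t (in_ball t tr).
have hzt := hz t tr; have htz := ht z zr.
have argD y : closure Om y -> D x0 <= D y -> B1 y.
  move=> Ky yx; apply/B1P; split => // q Kq; exact: le_trans (maxD q Kq) yx.
have Uz : U z <= U x0 by apply/maxU/argD; [exact: in_ball|rewrite /D in Dz Dt *; lra].
have Ut : U t <= U x0 by apply/maxU/argD; [exact: in_ball|rewrite /D in Dz Dt *; lra].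
(* equality holds throughout, so the whole ball consists of maximum points *)
have flatU y : enorm (y - x0) <= r -> U x0 <= U y by move=> yr; have := hz y yr; lra.
have flatW y : enorm (y - x0) <= r -> W x0 <= W y.
  by move=> yr; have := ht y yr; rewrite /D in Dz Dt; lra.
pose y := x0 + r *: delta_mx 0 i0.
have yr : enorm (y - x0) <= r.
  rewrite /y addrAC subrr add0r enormZ (ger0_norm (ltW r0)).
  by rewrite enorm_delta mulr1.
have B1y : B1 y.
  by apply: argD; [exact: in_ball|have := flatU y yr; have := flatW y yr; rewrite /D; lra].
have B2y : B2 y.
  apply/B2P; split => // q B1q; apply: le_trans (maxU q B1q) _; exact: flatU.
by have := maxc y B2y; rewrite /y !mxE !eqxx mulr1; lra.
Qed.

End comparison.

(** * The domain and its strip *)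

Section domain_geometry.
Context {R : realType} {N : nat}.
Local Notation V := 'rV[R]_N.
Variables (Om : set V) (gamma : R).
Hypotheses (oOm : open Om) (gamma0 : 0 < gamma).
Implicit Types (x y z p : V).

Lemma bdry_open x : bdry Om x <-> closure Om x /\ ~ Om x.
Proof. by rewrite /bdry ((interior_id Om).1 oOm); split=> -[]. Qed.

Lemma edist_le x z (A : set V) : A z -> Defs.edist x A <= enorm (x - z).
Proof.
move=> Az; apply: ge_inf; last by exists z.
by exists 0 => _ [t _ <-]; exact: enorm_ge0.
Qed.

(** A segment that leaves the domain crosses its boundary. *)
Lemma strip_near x y : closure Om x -> ~ Om y -> enorm (y - x) <= gamma ->
  outer_strip Om gamma y.
Proof.
move=> cx nOy yx; split=> //.
have [Ox|nOx] := pselect (Om x); last first.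
  by apply: le_trans yx; apply: edist_le; apply/bdry_open.
have [p [cp nOp] [_ e]] := segment_exit oOm Ox nOy.
apply: le_trans (edist_le _ (_ : bdry Om p)) _; first exact/bdry_open.
by move: yx; rewrite e; have := enorm_ge0 (p - x); lra.
Qed.

Lemma closure_domain : closure Om `<=` Om `|` outer_strip Om gamma.
Proof.
move=> x cx; have [Ox|nOx] := pselect (Om x); [by left|right].
by apply: (strip_near cx) => //; rewrite subrr enorm0 ltW.
Qed.

Lemma strip_disj x : Om x -> ~ outer_strip Om gamma x.
Proof. by move=> Ox [/(_ Ox)]. Qed.

Lemma strip_moves eps x y : eps <= gamma -> Om x -> eball x eps y ->
  (Om `|` outer_strip Om gamma) y.
Proof.
move=> eg Ox xy; have [Oy|nOy] := pselect (Om y); [by left|right].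
by apply: (strip_near (subset_closure Ox)) => //; exact: le_trans (ltW xy) eg.
Qed.

Hypotheses (N0 : (0 < N)%N) (bOm : bounded_set Om) (Om0 : Om !=set0).

Lemma bdry_neq0 : bdry Om !=set0.
Proof.
have [x Ox] := Om0; have /bounded_enormP[M hM] := bOm.
have M0 : 0 <= M by apply: le_trans (hM _ Ox); exact: enorm_ge0.
pose y : V := (M + 1) *: delta_mx 0 (Ordinal N0).
have nOy : ~ Om y.
  move=> /hM; rewrite /y enormZ enorm_delta mulr1 ger0_norm; last lra.
  by lra.
by have [p cp _] := segment_exit oOm Ox nOy; exists p; apply/bdry_open.
Qed.

Lemma bounded_domain_strip : bounded_set (Om `|` outer_strip Om gamma).
Proof.
have [q bq] := bdry_neq0; have /bounded_enormP[M hM] := bOm.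
have bM p : bdry Om p -> enorm p <= M + 1.
  move=> /bdry_open[/closure_enormP/(_ 1 ltr01)[y /hM yM yp] _].
  by have := enorm_triangle y p 0; rewrite !subr0 (enormB p y); lra.
apply/bounded_enormP; exists (M + 2 + gamma) => x [/hM|[_ xg]]; have g0 := gamma0; first lra.
have [|_ [p bp <-] hp] := @inf_adherent _ [set enorm (x - y) | y in bdry Om] 1 ltr01.
  split; first by exists (enorm (x - q)), q.
  by exists 0 => _ [t _ <-]; exact: enorm_ge0.
have := bM p bp; have := enorm_triangle p x 0; rewrite !subr0.
by rewrite /Defs.edist in xg; lra.
Qed.

End domain_geometry.

(** * Upper limits of asymptotically Lipschitz families *)

Section upper_limits.
Context {R : realType} {N : nat}.
Local Notation V := 'rV[R]_N.
Implicit Types (x y z p : V) (A Z : set V) (e L k C r : R).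

Lemma finite_net Z r : bounded_set Z -> 0 < r ->
  exists s : seq V, forall x, Z x -> exists2 c, c \in s & Z c /\ enorm (x - c) < r.
Proof.
move=> bZ r0.
have /bounded_enormP[M hM] := bZ.
have cK : compact (closure Z).
  apply: bounded_closed_compact; last exact: closed_closure.
  apply/bounded_enormP; exists (M + 1) => x /closure_enormP/(_ 1 ltr01)[y /hM yM yx].
  by have := enorm_triangle y x 0; rewrite !subr0 (enormB x y); lra.
have := cK; rewrite compact_cover => /(_ V Z (fun c => [set x | enorm (x - c) < r])).
case.
- move=> c _; apply/open_enormP => x /= xc; exists (r - enorm (x - c)); first by rewrite subr_gt0.
  by move=> y yx; have := enorm_triangle x y c; lra.
- move=> x /closure_enormP/(_ r r0)[c Zc xc]; exists c => //=.
  by rewrite enormB.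
move=> D hD cov; exists D => x Zx.
have [c /= Dc xc] := cov x (subset_closure Zx).
by exists c => //; split => //; have := hD c Dc; rewrite inE.
Qed.

Section family.
Variables (Z : set V) (f : R -> V -> R) (L k C g0 : R).
Hypotheses (bZ : bounded_set Z) (L0 : 0 <= L) (k0 : 0 <= k) (g00 : 0 < g0)
  (flip : forall e x y, 0 < e <= g0 -> Z x -> Z y ->
     f e y - f e x <= L * enorm (y - x) + k * e)
  (fC : forall e x, 0 < e <= g0 -> Z x -> `|f e x| <= C).

(** The upper bound is uniform, while the lower bound holds along values of the
    parameter that depend on the point. *)
Definition is_upper_limit (g : V -> R) :=
  (forall dl, 0 < dl -> exists2 eta, 0 < eta <= g0 &
     forall e x, 0 < e < eta -> Z x -> f e x <= g x + dl) /\
  (forall x dl eta, Z x -> 0 < dl -> 0 < eta ->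
     exists2 e, 0 < e < eta & e <= g0 /\ g x - dl <= f e x).

(** Pointwise upper limits do: the estimate [flip], uniform up to [k e], spreads
    the upper bound from a finite net to the whole set. *)
Lemma upper_limit_exists : exists2 g, elip L Z g & is_upper_limit g.
Proof.
pose T x := [set M | exists2 eta, 0 < eta <= g0 & forall e, 0 < e < eta -> f e x <= M].
pose g x := inf (T x).
have Tinf x : Z x -> has_inf (T x).
  move=> Zx; split.
    exists C, g0; first by rewrite g00 lexx.
    move=> e /andP[e0 eg]; have eg0 : 0 < e <= g0 by rewrite e0 ltW.
    by have := fC eg0 Zx; rewrite ler_norml => /andP[].
  exists (- C) => M [eta /andP[eta0 etag] h].
  have e1 : 0 < eta / 2 < eta by apply/andP; split; lra.
  have e2 : 0 < eta / 2 <= g0 by apply/andP; split; lra.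
  by have := fC e2 Zx; have := h _ e1; rewrite ler_norml => ? /andP[]; lra.
have up x dl : Z x -> 0 < dl -> exists2 eta, 0 < eta <= g0 &
    forall e, 0 < e < eta -> f e x <= g x + dl.
  move=> Zx dl0; have [M [eta eta0 h] Mg] := inf_adherent dl0 (Tinf x Zx).
  by exists eta => // e /h fM; exact: le_trans fM (ltW Mg).
have low x dl eta : Z x -> 0 < dl -> 0 < eta ->
    exists2 e, 0 < e < eta & e <= g0 /\ g x - dl <= f e x.
  move=> Zx dl0 eta0; apply: contrapT => none.
  have : g x <= g x - dl; last lra.
  apply: ge_inf; first by case: (Tinf x Zx).
  exists (Num.min eta g0); first by rewrite lt_min eta0 g00 ge_min lexx orbT.
  move=> e /andP[e0]; rewrite lt_min => /andP[e1 e2].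
  rewrite leNgt; apply/negP => h; apply: none; exists e; first by rewrite e0.
  by split; exact: ltW.
have glip : elip L Z g.
  move=> x y Zx Zy; apply/ler_addgt0Pr => dl dl0.
  have d3 : 0 < dl / 3 by lra.
  have [eta /andP[eta0 etag] h] := up x _ Zx d3.
  pose e1 := Num.min eta (dl / (3 * (k + 1))).
  have kk : 0 < 3 * (k + 1) by rewrite mulr_gt0// ltr_wpDl.
  have e10 : 0 < e1 by rewrite lt_min eta0 divr_gt0.
  have [e /andP[e0 ee1] [eg0 gy]] := low y _ _ Zy d3 e10.
  have [ee ek] : e < eta /\ e < dl / (3 * (k + 1)).
    by move: ee1; rewrite lt_min => /andP.
  have fx := h e _; rewrite e0 ee in fx; have {}fx := fx isT.
  have eg : 0 < e <= g0 by rewrite e0.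
  have := flip eg Zx Zy.
  by move: ek; rewrite ltr_pdivlMr//; have := mulr_ge0 k0 (ltW e0); lra.
exists g => //; split => // dl dl0.
have d4 : 0 < dl / 4 by lra.
have L1 : 0 < L + 1 by rewrite ltr_wpDl.
have r0 : 0 < dl / 4 / (L + 1) by rewrite divr_gt0.
have [s hs] := finite_net bZ r0.
have [eta /andP[eta0 etag] heta] : exists2 eta, 0 < eta <= g0 &
    forall e c, 0 < e < eta -> c \in s -> Z c -> f e c <= g c + dl / 4.
  elim: s {hs} => [|c s [eta /andP[eta0 etag] h]].
    by exists g0; [rewrite g00 lexx|].
  have [Zc|nZc] := pselect (Z c); last first.
    exists eta; first by rewrite eta0.
    by move=> e c' ee; rewrite inE => /orP[/eqP->//|]; exact: h.
  have [eta' /andP[eta'0 eta'g] h'] := up c _ Zc d4.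
  exists (Num.min eta eta'); first by rewrite lt_min eta0 eta'0 ge_min etag.
  move=> e c' /andP[e0]; rewrite lt_min => /andP[e1 e2].
  rewrite inE => /orP[/eqP-> _|cs Zc']; first by apply: h'; rewrite e0.
  by apply: h => //; rewrite e0.
pose eta1 := Num.min eta (dl / (4 * (k + 1))).
have kk : 0 < 4 * (k + 1) by rewrite mulr_gt0// ltr_wpDl.
exists eta1; first by rewrite /eta1 lt_min eta0 divr_gt0//= ge_min etag.
move=> e x /andP[e0]; rewrite lt_min => /andP[e1 e2] Zx.
have [c cs [Zc xc]] := hs x Zx.
have eg : 0 < e <= g0 by rewrite e0 (le_trans (ltW e1)).
have := flip eg Zc Zx; have := glip x c Zx Zc; rewrite (enormB c x).
have := heta e c; rewrite e0 e1 => /(_ isT cs Zc).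
move: xc e2; rewrite !ltr_pdivlMr// => xc e2.
by have := mulr_ge0 k0 (ltW e0); have := enorm_ge0 (x - c); lra.
Qed.

(** For small [e] the bounds on the boundary of [A] hold for [f e] on a layer of
    width [e] outside [A], up to a small error, and [discrete_cone] applies. *)
Lemma upper_limit_cone (Om : set V) O g : elip L Z g -> is_upper_limit g ->
  (forall e x y, 0 < e <= g0 -> Om x -> eball x e y -> Z y) ->
  bounded_set Om -> closure Om `<=` Z ->
  (forall e x, 0 < e <= g0 -> Om x -> (O x < (f e x)%:E)%E -> discrete_sub e (f e) x) ->
  cone_above Om O g.
Proof.
move=> lg [gup glow] moves bOm clZ sub A x a b oA AOm nAx b0 OA bA y0 Ay0.
have OmZ y : Om y -> Z y by move=> Oy; apply: clZ; exact: subset_closure.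
apply/ler_addgt0Pr => dl dl0.
have d4 : 0 < dl / 4 by lra.
have [eta /andP[eta0 etag] hup] := gup _ d4.
have kk : 0 < 4 * (L + 4 * b + 1) by have L0' := L0; lra.
pose e1 := Num.min eta (dl / (4 * (L + 4 * b + 1))).
have e10 : 0 < e1 by rewrite lt_min eta0 divr_gt0.
have [e /andP[e0 ee1] [eg0 gy]] := glow y0 _ _ (OmZ _ (AOm _ Ay0)) d4 e10.
have [ee ek] : e < eta /\ e < dl / (4 * (L + 4 * b + 1)).
  by move: ee1; rewrite lt_min => /andP.
have eg : 0 < e <= g0 by rewrite e0.
have [r hr] := bounded_radius bOm x.
have hf z : Z z -> f e z <= g z + dl / 4 by apply: hup; rewrite e0.
have be : 0 <= b * e by rewrite mulr_ge0// ltW.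
have Le : 0 <= L * e by rewrite mulr_ge0// ltW.
have : f e y0 <= (a + dl / 4 + (L + b) * e) + b * enorm (y0 - x) + 3 * b * e.
  apply: (@discrete_cone _ _ e b _ r C A x (f e)) => //.
  - by move=> y /AOm /hr.
  - move=> y /AOm /OmZ Zy; have := fC eg Zy.
    by rewrite ler_norml => /andP[].
  - move=> y Ay hy; apply: sub => //; first exact: AOm.
    by apply: le_lt_trans (OA y Ay) _; rewrite lte_fin; lra.
  - move=> y z Ay yz nAz.
    have [p [cp nAp] [_ yp]] := segment_exit oA Ay nAz.
    have Zz := moves _ _ _ eg (AOm _ Ay) yz.
    have Zp : Z p by apply: clZ; apply: closureS cp.
    have zp : enorm (z - p) <= e.
      have : enorm (z - y) < e by [].
      by rewrite yp; have := enorm_ge0 (p - y); lra.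
    have := hf z Zz; have := lg p z Zp Zz; have := bA p cp nAp.
    have := enorm_triangle z p x; rewrite (enormB p z) => /(ler_wpM2l b0).
    by have := ler_wpM2l L0 zp; have := ler_wpM2l b0 zp; lra.
by move: ek; rewrite ltr_pdivlMr//; lra.
Qed.

End family.
End upper_limits.

(** * Bent cones as test functions *)

Section directional_derivatives.
Context {R : realType} {N : nat}.
Local Notation V := 'rV[R]_N.
Implicit Types (x y v : V) (f g : V -> R).

(** Restricting a function to a line reduces its derivative in a direction to
    the derivative of a function of one real variable. *)
Lemma is_derive_line f y v l :
  is_derive (0 : R) 1 (fun h : R => f (h *: v + y)) l -> is_derive y v f l.
Proof.
move=> [d <-]; apply: DeriveDef; first exact/derivable1P.
rewrite /derive; set g1 := fun h => h^-1 *: _; set g2 := fun h => h^-1 *: _.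
suff -> : g1 = g2 by [].
by rewrite funeqE /g1 /g2 => h /=; rewrite addr0 scale0r add0r [_%:A]mulr1.
Qed.

Lemma is_derive_addf f g y v df dg : is_derive y v f df -> is_derive y v g dg ->
  is_derive y v (fun z => f z + g z) (df + dg).
Proof. exact: is_deriveD. Qed.

Lemma is_derive_mulf f g y v df dg : is_derive y v f df -> is_derive y v g dg ->
  is_derive y v (fun z => f z * g z) (f y * dg + g y * df).
Proof. exact: is_deriveM. Qed.

Lemma is_derive_invf f y v df : f y != 0 -> is_derive y v f df ->
  is_derive y v (fun z => (f z)^-1) (- (f y) ^- 2 * df).
Proof.
move=> f0 [d <-]; apply: DeriveDef; first exact: derivableV.
exact: deriveV.
Qed.

Lemma is_derive_cstf (c : R) y v : is_derive y v (fun=> c) 0.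
Proof. exact: is_derive_cst. Qed.

Lemma is_derive_coord x i y v : is_derive y v (fun z => (z - x) 0 i) (v 0 i).
Proof.
apply: is_derive_line.
rewrite (_ : (fun _ => _) = fun h : R => h * v 0 i + (y - x) 0 i).
  apply: is_derive_eq.
  by rewrite /GRing.scale /= ?mulr0 ?add0r ?mul0r ?addr0 ?mulr1.
by apply/funext => h; rewrite !mxE addrA.
Qed.

End directional_derivatives.

Section bent_cone.
Context {R : realType} {N : nat}.
Local Notation V := 'rV[R]_N.
Variables (x : V) (a b c : R).
Implicit Types (y v : V) (i j : 'I_N).

(** The quadratic term makes the infinity Laplacian negative, see
    [inf_laplacian_bent], while a small [c] hardly changes the cone. *)
Definition bent_cone y : R :=
  a + b * enorm (y - x) + (- c) * (enorm (y - x) * enorm (y - x)).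

(* D1 and D2 are the first and second partial derivatives away from x *)
Let k y := b * (enorm (y - x))^-1 + - (2 * c).
Let D1 i y := (y - x) 0 i * k y.
Let D2 i j y := (i == j)%:R * k y
  - b * (y - x) 0 i * (y - x) 0 j * (enorm (y - x)) ^- 3.

Lemma is_derive_enorm y v : y != x ->
  is_derive y v (fun z => enorm (z - x)) (dotv (y - x) v * (enorm (y - x))^-1).
Proof.
move=> yx; have z0 : 0 < dotv (y - x) (y - x).
  by rewrite lt0r dotvv_ge0 andbT dotvv_eq0 subr_eq0.
apply: is_derive_line.
pose p := fun h : R => h * (h * dotv v v + 2 * dotv (y - x) v) + dotv (y - x) (y - x).
rewrite (_ : (fun _ => _) = Num.sqrt \o p); last first.
  apply/funext => h /=; rewrite /enorm /p -addrA; congr Num.sqrt.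
  rewrite !(dotvDl, dotvDr, dotvZl, dotvZr) !dotvNl !dotvNr.
  by rewrite (dotvC v y) (dotvC v x) (dotvC x y); ring.
have p0 : p 0 = dotv (y - x) (y - x) by rewrite /p mul0r add0r.
have dp : is_derive (0 : R) 1 p (2 * dotv (y - x) v).
  apply: is_derive_eq; rewrite /GRing.scale /=.
  by rewrite !(mul0r, add0r, addr0, mulr0, mulr1).
have := @is_derive1_comp _ Num.sqrt p 0 (2 * Num.sqrt (p 0))^-1 (2 * dotv (y - x) v).
rewrite p0 => /(_ (is_derive1_sqrt z0) dp) => h.
apply: is_derive_eq; rewrite -/(enorm (y - x)).
have n0 : enorm (y - x) != 0 by rewrite enorm_eq0 subr_eq0.
by field.
Qed.

Lemma dotv_delta y i : dotv y (delta_mx 0 i) = y 0 i.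
Proof.
rewrite /dotv (bigD1 i)//= big1 ?addr0; first by rewrite mxE !eqxx mulr1.
by move=> j /negPf ji; rewrite mxE ji andbF mulr0.
Qed.

Lemma is_derive_bent i y : y != x ->
  is_derive y (delta_mx 0 i : V) bent_cone (D1 i y).
Proof.
move=> yx; have n0 : enorm (y - x) != 0 by rewrite enorm_eq0 subr_eq0.
have dn := is_derive_enorm (delta_mx 0 i) yx.
have := is_derive_addf (is_derive_addf (is_derive_cstf a y (delta_mx 0 i))
  (is_derive_mulf (is_derive_cstf b y (delta_mx 0 i)) dn))
  (is_derive_mulf (is_derive_cstf (- c) y (delta_mx 0 i)) (is_derive_mulf dn dn)).
move=> h; apply: is_derive_eq h _; rewrite /D1 /k dotv_delta.
by field.
Qed.

Lemma is_derive_k j y : y != x ->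
  is_derive y (delta_mx 0 j : V) k (- b * (y - x) 0 j * (enorm (y - x)) ^- 3).
Proof.
move=> yx; have n0 : enorm (y - x) != 0 by rewrite enorm_eq0 subr_eq0.
have dn := is_derive_enorm (delta_mx 0 j) yx.
have := is_derive_addf (is_derive_mulf (is_derive_cstf b y (delta_mx 0 j))
  (@is_derive_invf _ _ (fun z : V => enorm (z - x)) _ _ _ n0 dn)) (is_derive_cstf (- (2 * c)) y (delta_mx 0 j)).
move=> h; apply: is_derive_eq h _; rewrite dotv_delta.
by field.
Qed.

Lemma is_derive_D1 i j y : y != x ->
  is_derive y (delta_mx 0 j : V) (D1 i) (D2 i j y).
Proof.
move=> yx.
have := is_derive_mulf (is_derive_coord x i y (delta_mx 0 j)) (is_derive_k j yx).
move=> h; apply: is_derive_eq h _; rewrite /D2 [delta_mx _ _ _ _]mxE eqxx /=.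
by ring.
Qed.

Lemma near_neq y : y != x -> \forall z \near y, z != x.
Proof.
move=> yx; apply/nbhs_enorm; exists (enorm (y - x)); first by rewrite enorm_gt0 subr_eq0.
by move=> z zy; apply/eqP => zx; rewrite zx enormB ltxx in zy.
Qed.

Lemma partial_bent i y : y != x -> partial bent_cone i y = D1 i y.
Proof. by move=> yx; have [_] := is_derive_bent i yx. Qed.

Lemma near_partial_bent i y : y != x -> \forall z \near y, D1 i z = partial bent_cone i z.
Proof. by move=> yx; apply: filterS (near_neq yx) => z zx; rewrite partial_bent. Qed.

Lemma is_derive_partial_bent i j y : y != x ->
  is_derive y (delta_mx 0 j : V) (partial bent_cone i) (D2 i j y).
Proof.
move=> yx; apply: near_eq_is_derive (is_derive_D1 i j yx).
exact: near_partial_bent.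
Qed.

Lemma partial2_bent i j y : y != x -> partials bent_cone [:: i; j] y = D2 i j y.
Proof. by move=> yx; have [_] := is_derive_partial_bent i j yx. Qed.

Lemma near_eq_continuous (f g : V -> R) y : (\forall z \near y, f z = g z) ->
  {for y, continuous f} -> {for y, continuous g}.
Proof.
move=> fg cf; rewrite /prop_for /continuous_at -(nbhs_singleton fg).
exact: cvg_trans (near_eq_cvg fg) cf.
Qed.

Lemma continuous_enorm_sub y : {for y, continuous (fun z : V => enorm (z - x))}.
Proof. exact: (elip_continuous ler01 (@elip_enorm R N x setT)). Qed.

Lemma continuous_coord_sub i y : {for y, continuous (fun z : V => (z - x) 0 i)}.
Proof.
rewrite (_ : (fun _ => _) = (fun z : V => z 0 i - x 0 i)); last by apply/funext => z; rewrite !mxE.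
by apply: continuousB; [exact: coord_continuous|exact: cst_continuous].
Qed.

Lemma continuous_k y : y != x -> {for y, continuous k}.
Proof.
move=> yx; apply: continuousD; last exact: cst_continuous.
apply: continuousM; first exact: cst_continuous.
by apply: continuousV; [rewrite enorm_eq0 subr_eq0|exact: continuous_enorm_sub].
Qed.

Lemma bent_cone_continuous : continuous bent_cone.
Proof.
move=> y; suff : {for y, continuous bent_cone} by [].
apply: continuousD.
  apply: continuousD; first exact: cst_continuous.
  by apply: continuousM; [exact: cst_continuous|exact: continuous_enorm_sub].
apply: continuousM; first exact: cst_continuous.
by apply: continuousM; exact: continuous_enorm_sub.
Qed.

Lemma bent_cone_C2 : Ck 2 [set y | y != x] bent_cone.
Proof.
split=> [s y sz /= yx|s i y sz /= yx]; last first.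
  case: s sz => [_|j [|//] _] /=; first by have [] := is_derive_bent i yx.
  by have [] := is_derive_partial_bent j i yx.
case: s sz => [_|i [_|j [_|//]]] /=.
- exact: bent_cone_continuous.
- apply: near_eq_continuous (near_partial_bent i yx) _.
  by apply: continuousM; [exact: continuous_coord_sub|exact: continuous_k].
- have near2 : \forall z \near y, D2 i j z = partial (partial bent_cone i) j z.
    by apply: filterS (near_neq yx) => z zx; rewrite -partial2_bent.
  apply: near_eq_continuous near2 _; apply: continuousB.
    by apply: continuousM; [exact: cst_continuous|exact: continuous_k].
  apply: continuousM; last first.
    apply: continuousV; first by rewrite expf_neq0// enorm_eq0 subr_eq0.
    rewrite (_ : (fun _ => _) = fun z : V => enorm (z - x) * (enorm (z - x) * enorm (z - x))).
      by apply: continuousM; [|apply: continuousM]; exact: continuous_enorm_sub.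
    by apply/funext => z; ring.
  apply: continuousM; last exact: continuous_coord_sub.
  by apply: continuousM; [exact: cst_continuous|exact: continuous_coord_sub].
Qed.

(** The gradient is an eigenvector of the Hessian, as for every radial function,
    and the second derivative along a ray is [- 2 c]. *)
Lemma inf_laplacian_bent y : y != x ->
  inf_laplacian bent_cone y = - (2 * c) * (b - 2 * c * enorm (y - x)) ^+ 2.
Proof.
move=> yx; have n0 : enorm (y - x) != 0 by rewrite enorm_eq0 subr_eq0.
have gradE : grad bent_cone y = k y *: (y - x).
  by apply/rowP => i; rewrite !mxE partial_bent// /D1 !mxE mulrC.
have -> : inf_laplacian bent_cone y =
    dotv ((k y * - (2 * c)) *: (y - x)) (k y *: (y - x)).
  rewrite /inf_laplacian gradE; congr dotv; apply/rowP => j.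
  rewrite !mxE.
  transitivity (\sum_i ((i == j)%:R * (k y * k y * (y - x) 0 i) -
      k y * b * (y - x) 0 j * enorm (y - x) ^- 3 * ((y - x) 0 i * (y - x) 0 i))).
    apply: eq_bigr => i _; rewrite [hess _ _ _ _]mxE partial2_bent// /D2.
    by rewrite [X in X * _]mxE; ring.
  rewrite sumrB (bigD1 j)//= big1 ?addr0; last first.
    by move=> i /negPf ij; rewrite ij mul0r.
  rewrite eqxx mul1r -mulr_sumr -/(dotv (y - x) (y - x)).
  rewrite -enorm_sqr /k !mxE.
  by field.
rewrite dotvZl dotvZr -enorm_sqr /k.
by field.
Qed.

End bent_cone.

(** * Viscosity solutions compare with cones *)

Section viscosity_cones.
Context {R : realType} {N : nat}.
Local Notation V := 'rV[R]_N.
Implicit Types (x y z : V) (A U Om Gam Z : set V) (phi v w : V -> R).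

(** The hypothesis [Ck] enters because [derive] is additive only where the limits
    exist. *)
Lemma partials_opp U phi s x : open U -> Ck 2 U phi -> (size s <= 2)%N -> U x ->
  partials (\- phi) s x = - partials phi s x.
Proof.
move=> oU [_ dphi]; elim/last_ind: s x => [//|s i IH] x.
rewrite size_rcons => s2 Ux; rewrite /partials !foldl_rcons -!/(partials _ s).
rewrite /partial -deriveN; last exact: dphi.
apply: near_eq_derive; apply: filterS (open_nbhs_nbhs (conj oU Ux)) => y Uy.
by rewrite IH// ltnW.
Qed.

Lemma Ck2_opp U phi : open U -> Ck 2 U phi -> Ck 2 U (\- phi).
Proof.
move=> oU ck; have [cphi dphi] := ck; split=> [s x s2 Ux|s i x s2 Ux].
  apply: (@near_eq_continuous R N (\- partials phi s)); last exact/continuousN/cphi.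
  apply: filterS (open_nbhs_nbhs (conj oU Ux)) => y Uy.
  by rewrite (partials_opp oU ck).
apply: (@near_eq_derivable _ _ _ (\- partials phi s)); last exact/derivableN/dphi.
apply: filterS (open_nbhs_nbhs (conj oU Ux)) => y Uy.
by rewrite (partials_opp oU ck)// ltnW.
Qed.

Lemma inf_laplacian_opp U phi x : open U -> Ck 2 U phi -> U x ->
  inf_laplacian (\- phi) x = - inf_laplacian phi x.
Proof.
move=> oU ck Ux.
have gN : grad (\- phi) x = - grad phi x.
  by apply/rowP => i; rewrite !mxE; exact: (@partials_opp U phi [:: i]).
have hN : hess (\- phi) x = - hess phi x.
  by apply/matrixP => i j; rewrite !mxE; exact: (@partials_opp U phi [:: i; j]).
by rewrite /inf_laplacian gN hN mulmxN mulNmx opprK dotvNr.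
Qed.

Lemma open_setD1 A x : open A -> open (A `\ x).
Proof.
move=> /open_enormP oA; apply/open_enormP => y [Ay /eqP yx].
have [r r0 hr] := oA y Ay.
exists (Num.min r (enorm (y - x))); first by rewrite lt_min r0 enorm_gt0 subr_eq0.
move=> z; rewrite lt_min => /andP[zr zx]; split; first exact: hr.
by move=> /= e; move: zx; rewrite e enormB ltxx.
Qed.

(** If the function exceeded the cone somewhere, it would still exceed a slightly
    steeper bent cone there; their difference would be largest at an interior
    point, where the bent cone violates the inequality for test functions. *)
Lemma viscosity_cone Om (O : V -> \bar R) v : bounded_set Om ->
  {within closure Om, continuous v} ->
  (forall x phi, Om x -> (O x < (v x)%:E)%E -> C2_near x phi ->
     local_max_at (v \- phi) x -> 0 <= inf_laplacian phi x) ->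
  cone_above Om O v.
Proof.
move=> bOm cv visc A x a b oA AOm nAx b0 OA bA y0 Ay0.
rewrite leNgt; apply/negP => bad.
pose gap := v y0 - (a + b * enorm (y0 - x)).
have gap0 : 0 < gap by rewrite subr_gt0.
have [r0 hr0] := bounded_radius bOm x.
pose r := Num.max r0 0 + 1.
have r_gt0 : 0 < r by rewrite ltr_wpDl// le_max lexx orbT.
have clr y : closure A y -> enorm (y - x) <= r.
  move=> /closure_enormP/(_ 1 ltr01)[z /AOm/hr0 zr zy].
  have : enorm (z - x) <= Num.max r0 0 by rewrite le_max zr.
  by have := enorm_triangle z y x; rewrite (enormB y z) /r; lra.
pose e := gap / (2 * r); have e0 : 0 < e by rewrite divr_gt0// mulr_gt0.
have er : e * r * 2 = gap by rewrite /e; field; rewrite gt_eqF.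
pose c := e / (4 * r); have c0 : 0 < c by rewrite divr_gt0// mulr_gt0.
have cr : c * r * 4 = e by rewrite /c; field; rewrite gt_eqF.
pose phi := bent_cone x a (b + e) c.
have phi_ge y : closure A y -> a + b * enorm (y - x) <= phi y.
  move=> cy; rewrite /phi /bent_cone; set t := enorm (y - x).
  have t0 : 0 <= t by exact: enorm_ge0.
  have ct : c * t <= e by have := ler_wpM2l (ltW c0) (clr y cy); rewrite -/t; lra.
  by have := ler_wpM2l t0 ct; lra.
have phi_y0 : phi y0 < v y0.
  rewrite /phi /bent_cone; set t := enorm (y0 - x).
  have tr : t <= r by apply: clr; exact: subset_closure.
  have := ler_wpM2l (ltW e0) tr; have : 0 <= c * (t * t)
    by apply: mulr_ge0; [exact: ltW|apply: mulr_ge0; exact: enorm_ge0].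
  by move: er gap0; rewrite /gap -/t; lra.
have clAOm : closure A `<=` closure Om by exact: closureS.
have cphi : continuous phi by exact: bent_cone_continuous.
have [||y1 cy1 max1] := @max_on_compact _ _ (closure A) (v \- phi) (ex_intro _ y0 (subset_closure Ay0)).
- apply: bounded_closed_compact; last exact: closed_closure.
  apply/bounded_enormP; exists (r + enorm x) => y /clr yr.
  by have := enorm_triangle x y 0; rewrite !subr0; lra.
- have cvA : {within closure A, continuous v} by exact: continuous_subspaceW cv.
  move=> y; apply: continuousB; first exact: cvA.
  by apply: continuous_subspaceT; exact: cphi.
have vphi : phi y1 < v y1.
  by have := max1 y0 (subset_closure Ay0) => /=; lra.
have Ay1 : A y1.
  by apply: contrapT => nA; have := bA y1 cy1 nA; have := phi_ge y1 cy1; lra.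
have y1x : y1 != x by apply/eqP => e1; apply: nAx; rewrite -e1.
have := visc y1 phi (AOm _ Ay1).
rewrite (le_lt_trans (OA y1 Ay1)); last first.
  by rewrite lte_fin; have := phi_ge y1 cy1; lra.
move=> /(_ isT) h.
have : 0 <= inf_laplacian phi y1.
  apply: h.
    exists [set y | y != x]; last exact: bent_cone_C2.
    split => //; rewrite openE => y yx; exact: near_neq.
  apply: filterS (open_nbhs_nbhs (conj oA Ay1)) => y Ay.
  exact/max1/subset_closure.
rewrite inf_laplacian_bent// leNgt => /negP; apply.
have ct : c * enorm (y1 - x) <= c * r by rewrite ler_pM2l//; exact: clr.
have d0 : 0 < b + e - 2 * c * enorm (y1 - x) by lra.
by rewrite mulNr oppr_lt0; apply: mulr_gt0; [lra|exact: exprn_gt0].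
Qed.

Lemma solution_cones Om Gam F Psi v : open Om -> bounded_set Om ->
  closure Om `<=` Om `|` Gam ->
  obstacle_solution Om Gam F Psi v ->
  cone_above Om (EFin \o Psi) v /\ cone_above Om (fun=> -oo%E) (\- v).
Proof.
move=> oOm bOm clOm [cv [_ super] _ _ [_ [_ sub]]].
have cvOm : {within closure Om, continuous v} by exact: continuous_subspaceW cv.
split; apply: viscosity_cone => //.
- move=> x phi Ox; rewrite lte_fin => Px c2 /sub h.
  by have := h (conj Ox Px) c2; rewrite oppr_le0.
- by move=> x; apply: continuousN; exact: cvOm.
move=> x phi Ox _ [U [oU Ux] ck] lmax.
have := super x (\- phi) Ox.
rewrite (inf_laplacian_opp oU ck Ux) opprK; apply.
  by exists U; [split|exact: (Ck2_opp oU ck)].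
by apply: filterS lmax => y /=; rewrite !opprK; lra.
Qed.

(** Same argument as for the values of the game: first a vertex on the strip,
    then a vertex in the domain. *)
Lemma cone_lipschitz Om Gam (F Psi v : V -> R) L : open Om -> 0 <= L ->
  closure Om `<=` Om `|` Gam -> (forall x, Om x -> ~ Gam x) ->
  elip L Gam F -> elip L setT Psi -> (forall x, Gam x -> Psi x <= F x) ->
  (forall x, Gam x -> v x = F x) -> (forall x, Om x -> Psi x <= v x) ->
  cone_above Om (EFin \o Psi) v -> cone_above Om (fun=> -oo%E) (\- v) ->
  elip L (Om `|` Gam) v.
Proof.
move=> oOm L0 clOm disj lF lP PF vF Pv c1 c2.
have lG : elip L Gam v by move=> x y Gx Gy; rewrite !vF//; exact: lF.
have bG y : closure Om y -> ~ Om y -> Gam y by move=> /clOm[].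
have Pcone x y : Psi x <= v x -> ((EFin \o Psi) y <= (v x + L * enorm (y - x))%:E)%E.
  by move=> h; rewrite lee_fin; have := lP x y I I; lra.
have up z y : Gam z -> Om y -> v y <= v z + L * enorm (y - z).
  move=> Gz; apply: c1 => //; first by move=> /disj.
    by move=> t _; apply: Pcone; rewrite vF//; exact: PF.
  by move=> t ct nOt; rewrite -lerBlDl; apply: lG => //; exact: bG.
have low z y : Gam z -> Om y -> v z <= v y + L * enorm (y - z).
  move=> Gz Oy.
  have h : forall t, Om t -> (\- v) t <= (\- v) z + L * enorm (t - z).
    apply: c2 => //; first by move=> /disj.
      by move=> t _; rewrite leNye.
    move=> t ct nOt /=; have := lG t z (bG t ct nOt) Gz.
    by rewrite enormB; lra.
  by have := h y Oy => /=; lra.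
move=> x y [Ox|Gx] [Oy|Gy].
- rewrite lerBlDl; have [->|yx] := eqVneq y x; first by rewrite subrr enorm0; lra.
  have : forall t, (Om `\ x) t -> v t <= v x + L * enorm (t - x).
    apply: c1 => //.
    + exact: open_setD1.
    + by move=> [_ /(_ erefl)].
    + by move=> t _; apply: Pcone; exact: Pv.
    move=> t ct nt; have [Ot|nOt] := pselect (Om t).
      have -> : t = x by apply: contrapT => tx; apply: nt.
      by rewrite subrr enorm0; lra.
    have cOt : closure Om t by apply: closureS ct => ? [].
    by have := low t x (bG t cOt nOt) Ox; rewrite enormB.
  by apply; split => //= e; rewrite e eqxx in yx.
- by have := low y x Gy Ox; rewrite enormB; lra.
- by have := up x y Gx Oy; lra.
- exact: lG.
Qed.

End viscosity_cones.

(** * Second-order Taylor expansion *)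

Section taylor.
Context {R : realType} {N : nat}.
Local Notation V := 'rV[R]_N.
Implicit Types (x y v : V) (U : set V) (f phi : V -> R).

Lemma is_derive_along f y v (s l : R) : is_derive (s *: v + y) v f l ->
  is_derive s 1 (fun h : R => f (h *: v + y)) l.
Proof.
have E : (fun h : R => h^-1 *: ((f \o shift (s *: v + y)) (h *: v) - f (s *: v + y))) =
  (fun h : R => h^-1 *: (((fun h : R => f (h *: v + y)) \o shift s) (h *: 1) -
     f (s *: v + y))).
  by apply/funext => h /=; rewrite addrA -scalerDl [_%:A]mulr1.
move=> [d <-]; apply: DeriveDef; first by rewrite /derivable -E.
by rewrite /derive -E.
Qed.

Lemma segment_MVT (g dg : R -> R) :
  (forall t : R, 0 <= t <= 1 -> is_derive t (1 : R) g (dg t)) ->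
  exists2 t, 0 <= t <= 1 & g 1 - g 0 = dg t.
Proof.
move=> h.
have dgt (t : R) : t \in `]0, 1[ -> is_derive t 1 g (dg t).
  by rewrite in_itv /= => /andP[t0 t1]; apply: h; rewrite !ltW.
have cg : {within `[0, 1], continuous g}.
  apply: derivable_within_continuous => t; rewrite in_itv /= => t01.
  by have [] := h t t01.
have [t] := MVT_segment ler01 dgt cg.
by rewrite in_itv /= subr0 mulr1 => t01 e; exists t.
Qed.

(** The coordinates of [v] are switched on one by one, so that consecutive points
    differ in one coordinate and the mean value theorem applies. *)
Definition cut k v : V := \row_i (if (i < k)%N then v 0 i else 0).

Lemma enorm_le_coord v (w : V) : (forall i, `|v 0 i| <= `|w 0 i|) -> enorm v <= enorm w.
Proof.
move=> h; rewrite ler_wsqrtr//; apply: ler_sum => i _.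
by rewrite -!expr2 -[leLHS]real_normK ?num_real// -[leRHS]real_normK ?num_real// lerXn2r ?nnegrE.
Qed.

Lemma C1_expansion U f x : open U -> U x ->
  (forall y i, U y -> derivable f y (delta_mx 0 i)) ->
  (forall i, {for x, continuous (partial f i)}) ->
  forall e, 0 < e -> exists2 r, 0 < r & forall v, enorm v < r ->
    `|f (x + v) - f x - dotv v (grad f x)| <= e * enorm v.
Proof.
move=> /open_enormP oU Ux df cf e e0.
have [r1 r10 hr1] := oU x Ux.
pose e' := e / N.+1%:R; have e'0 : 0 < e' by rewrite divr_gt0.
have [r r0 hr] : exists2 r, 0 < r & forall i y, enorm (y - x) < r ->
    `|partial f i y - partial f i x| <= e'.
  have near_all : \forall y \near x, forall i, `|partial f i y - partial f i x| <= e'.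
    apply: (@filter_forall V 'I_N (fun i =>
      [set y | `|partial f i y - partial f i x| <= e']) (nbhs x) _) => i.
    have /continuous_enormP/(_ _ e'0)[r2 r20 h2] := cf i.
    by apply/nbhs_enorm; exists r2 => // y /h2/ltW.
  by move: near_all => /nbhs_enorm[r2 r20 h2]; exists r2 => // i y /h2; exact.
exists (Num.min r1 r); first by rewrite lt_min r10.
move=> v; rewrite lt_min => /andP[vr1 vr].
have step (i : 'I_N) : `|f (x + cut i.+1 v) - f (x + cut i v) - v 0 i * partial f i x|
    <= e' * enorm v.
  pose y (t : R) : V := (t * v 0 i) *: delta_mx 0 i + (x + cut i v).
  have yx t : 0 <= t <= 1 -> enorm (y t - x) <= enorm v.
    move=> /andP[t0 t1]; apply: enorm_le_coord => j.
    have -> : y t - x = (t * v 0 i) *: delta_mx 0 i + cut i v.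
      by rewrite /y (addrC x) addrA addrK.
    rewrite !mxE eqxx /=; have [->|ij] := eqVneq j i.
      by rewrite ltnn addr0 mulr1 normrM ger0_norm// ler_piMl.
    by rewrite mulr0 add0r; case: ifP => //; rewrite normr0.
  have [|t t01 e1] := @segment_MVT (fun t => f (y t)) (fun t => partial f i (y t) * v 0 i) _.
    move=> t t01.
    have d1 : is_derive (t * v 0 i) 1 (fun s : R => f (s *: delta_mx 0 i + (x + cut i v)))
        (partial f i (y t)).
      apply: is_derive_along; apply: derivableP; apply: df; apply: hr1.
      exact: le_lt_trans (yx t t01) vr1.
    have d2 : is_derive t 1 (fun s : R => s * v 0 i) (v 0 i).
      apply: is_derive_eq; rewrite /GRing.scale /=.
      by rewrite mulr0 add0r mulr1.
    exact: (@is_derive1_comp _ (fun s : R => f (s *: delta_mx 0 i + (x + cut i v)))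
      (fun s : R => s * v 0 i) t _ _ d1 d2).
  have y0 : y 0 = x + cut i v by rewrite /y mul0r scale0r add0r.
  have y1 : y 1 = x + cut i.+1 v.
    rewrite /y mul1r addrCA; congr (_ + _); apply/rowP => j; rewrite !mxE eqxx /=.
    have [->|ij] := eqVneq j i; first by rewrite ltnn ltnSn addr0 mulr1.
    rewrite mulr0 add0r [in RHS]ltnS [in RHS]leq_eqVlt.
    by rewrite (_ : (j == i :> nat) = false)//; apply/negbTE.
  rewrite y0 y1 in e1; rewrite e1 mulrC -mulrBr normrM mulrC.
  apply: ler_pM => //; last exact: coord_le_enorm.
  by apply: hr; exact: le_lt_trans (yx t t01) vr.
have -> : f (x + v) - f x - dotv v (grad f x) =
    \sum_(i < N) (f (x + cut i.+1 v) - f (x + cut i v) - v 0 i * partial f i x).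
  rewrite sumrB /dotv; congr (_ - _); last by apply: eq_bigr => i _; rewrite mxE.
  rewrite -(big_mkord xpredT (fun i => f (x + cut i.+1 v) - f (x + cut i v))).
  rewrite (telescope_sumr (fun i => f (x + cut i v)))//; congr (f (x + _) - f _).
    by apply/rowP => i; rewrite mxE ltn_ord.
  by rewrite (_ : cut 0 v = 0) ?addr0//; apply/rowP => i; rewrite !mxE.
apply: le_trans (ler_norm_sum _ _ _) _.
apply: (@le_trans _ _ (\sum_(i < N) e' * enorm v)).
  by apply: ler_sum => i _; exact: step.
rewrite sumr_const card_ord -mulr_natl mulrA ler_wpM2r ?enorm_ge0//.
by rewrite /e' mulrA ler_pdivrMr// mulrC ler_pM2l// ler_nat.
Qed.

(** Continuous partial derivatives exist in all directions, and the derivative is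
    linear in the direction. *)
Lemma C1_is_derive U f x v : open U -> U x ->
  (forall y i, U y -> derivable f y (delta_mx 0 i)) ->
  (forall i, {for x, continuous (partial f i)}) ->
  is_derive x v f (dotv v (grad f x)).
Proof.
move=> oU Ux df cf.
suff cv : (fun h : R => h^-1 *: ((f \o shift x) (h *: v) - f x)) @ 0^' --> dotv v (grad f x).
  by apply: DeriveDef; [apply/cvg_ex; exists (dotv v (grad f x))|exact: cvg_lim].
apply/cvgrPdist_le => e e0.
have k0 : 0 < enorm v + 1 by rewrite ltr_wpDl ?enorm_ge0.
have [r r0 hr] := C1_expansion oU Ux df cf (divr_gt0 e0 k0).
have rk : 0 < r / (enorm v + 1) by rewrite divr_gt0.
exists (r / (enorm v + 1)) => // h /=; rewrite sub0r normrN => hs h0.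
have := hr (h *: v); rewrite enormZ => /(_ _) H.
have {}H : `|f (x + h *: v) - f x - dotv (h *: v) (grad f x)| <= e / (enorm v + 1) * (`|h| * enorm v).
  apply: H; apply: (@le_lt_trans _ _ (`|h| * (enorm v + 1))).
    by rewrite ler_wpM2l// lerDl.
  by rewrite -ltr_pdivlMr.
rewrite distrC addrC.
have -> : - dotv v (grad f x) + h^-1 *: (f (h *: v + x) - f x) =
    h^-1 * (f (x + h *: v) - f x - dotv (h *: v) (grad f x)).
  rewrite dotvZl mulrBr mulKf// addrC; congr (_ - _).
  by rewrite (addrC x).
rewrite normrM normfV ler_pdivrMl ?normr_gt0//.
apply: le_trans H _; rewrite mulrCA ler_wpM2l//.
rewrite -[leRHS]mulr1 mulrAC -mulrA ler_wpM2l ?(ltW e0)//.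
by rewrite ler_pdivrMr// mul1r lerDl.
Qed.

(** Mean value theorem along the segment for the remainder [psi]: its derivative
    is controlled by the first-order expansions of the partial derivatives. *)
Lemma C2_expansion U phi x : open U -> U x -> Ck 2 U phi ->
  forall e, 0 < e -> exists2 r, 0 < r & forall v, enorm v < r ->
    `|phi (x + v) - phi x - dotv v (grad phi x) - dotv (v *m hess phi x) v / 2|
      <= e * enorm v ^+ 2.
Proof.
move=> oU Ux [cphi dphi] e e0.
have dphi0 y i : U y -> derivable phi y (delta_mx 0 i) by exact: (dphi [::] i y).
have dphi1 y i j : U y -> derivable (partial phi i) y (delta_mx 0 j).
  exact: (dphi [:: i] j y).
have [r1 r10 hr1] := (open_enormP _).1 oU x Ux.
pose e' := e / N.+1%:R; have e'0 : 0 < e' by rewrite divr_gt0.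
have [r r0 hr] : exists2 r, 0 < r & forall i v, enorm v < r ->
    `|partial phi i (x + v) - partial phi i x - dotv v (grad (partial phi i) x)|
      <= e' * enorm v.
  have near_all : \forall y \near x, forall i : 'I_N,
      `|partial phi i (x + (y - x)) - partial phi i x -
        dotv (y - x) (grad (partial phi i) x)| <= e' * enorm (y - x).
    apply: (@filter_forall V 'I_N (fun i =>
      [set y | `|partial phi i (x + (y - x)) - partial phi i x -
        dotv (y - x) (grad (partial phi i) x)| <= e' * enorm (y - x)]) (nbhs x) _) => i.
    have [||r2 r20 h2] := @C1_expansion U (partial phi i) x oU Ux _ _ _ e'0.
    - by move=> y j Uy; exact: dphi1.
    - by move=> j; exact: (cphi [:: i; j] x).
    by apply/nbhs_enorm; exists r2 => // y; exact: h2.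
  move: near_all => /nbhs_enorm[r2 r20 h2]; exists r2 => // i v vr.
  by have := h2 (x + v); rewrite addrAC subrr add0r => /(_ vr i).
exists (Num.min r1 r); first by rewrite lt_min r10.
move=> v; rewrite lt_min => /andP[vr1 vr].
pose p := grad phi x; pose X := hess phi x.
pose psi t := phi (t *: v + x) + - (t * dotv v p + t * t * (dotv (v *m X) v / 2)).
have [|t t01] := @segment_MVT psi (fun t => dotv v (grad phi (t *: v + x)) +
    - (dotv v p + 2 * t * (dotv (v *m X) v / 2))) _.
  move=> t /andP[t0 t1].
  have Ut : U (t *: v + x).
    apply: hr1; rewrite addrK enormZ ger0_norm//.
    by apply: le_lt_trans vr1; rewrite ler_piMl ?enorm_ge0.
  have d1 : is_derive t 1 (fun h : R => phi (h *: v + x)) (dotv v (grad phi (t *: v + x))).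
    apply: is_derive_along; apply: (C1_is_derive _ oU) => // i.
    exact: (cphi [:: i] (t *: v + x)).
  have d2 : is_derive t 1 (fun h : R => - (h * dotv v p + h * h * (dotv (v *m X) v / 2)))
      (- (dotv v p + 2 * t * (dotv (v *m X) v / 2))).
    by apply: is_derive_eq; rewrite /GRing.scale /=; ring.
  exact: is_deriveD.
move=> e1.
have {e1} -> : phi (x + v) - phi x - dotv v (grad phi x) - dotv (v *m hess phi x) v / 2 =
    dotv v (grad phi (t *: v + x)) + - (dotv v p + 2 * t * (dotv (v *m X) v / 2)).
  rewrite -e1 /psi scale1r scale0r (addrC v) add0r -/p -/X; ring.
have -> : dotv v (grad phi (t *: v + x)) + - (dotv v p + 2 * t * (dotv (v *m X) v / 2)) =
    \sum_i v 0 i * (partial phi i (x + t *: v) - partial phi i x -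
      dotv (t *: v) (grad (partial phi i) x)).
  have quad : dotv (v *m X) v = \sum_i v 0 i * dotv v (grad (partial phi i) x).
    rewrite /dotv; under eq_bigr => j _ do rewrite mxE mulr_suml.
    rewrite exchange_big; apply: eq_bigr => i _ /=.
    by rewrite mulr_sumr; apply: eq_bigr => j _; rewrite /X !mxE /partials /=; ring.
  rewrite (eq_bigr (fun i => v 0 i * grad phi (t *: v + x) 0 i - (v 0 i * p 0 i +
      t * (v 0 i * dotv v (grad (partial phi i) x))))); last first.
    by move=> i _; rewrite !mxE (addrC x) dotvZl; ring.
  by rewrite sumrB big_split /= -mulr_sumr -quad -!/(dotv _ _); field.
apply: le_trans (ler_norm_sum _ _ _) _.
apply: (@le_trans _ _ (\sum_(i < N) e' * enorm v ^+ 2)).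
  apply: ler_sum => i _; rewrite normrM expr2 mulrCA.
  apply: ler_pM => //; first exact: coord_le_enorm.
  have /andP[t0 t1] := t01.
  have tv : enorm (t *: v) <= enorm v.
    by rewrite enormZ ger0_norm// ler_piMl ?enorm_ge0.
  apply: le_trans (hr i (t *: v) (le_lt_trans tv vr)) _.
  by rewrite ler_pM2l.
rewrite sumr_const card_ord -mulr_natl mulrA ler_wpM2r ?sqr_ge0//.
by rewrite /e' mulrA ler_pdivrMr// mulrC ler_pM2l// ler_nat.
Qed.

End taylor.

(** * Comparison with cones implies the viscosity inequality *)

Section cones_to_viscosity.
Context {R : realType} {N : nat}.
Local Notation V := 'rV[R]_N.
Implicit Types (x y z v : V) (Om U : set V) (phi w : V -> R).

Lemma mulmx_form_bound (X : 'M[R]_N) : exists2 B, 0 <= B &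
  forall y z, dotv (y *m X) z <= B * enorm y * enorm z.
Proof.
exists (\sum_j \sum_i `|X i j|); first by apply: sumr_ge0 => j _; exact: sumr_ge0.
move=> y z; rewrite /dotv !mulr_suml; apply: ler_sum => j _.
rewrite mxE !mulr_suml; apply: ler_sum => i _.
apply: le_trans (ler_norm _) _; rewrite !normrM mulrAC mulrC -!mulrA.
have yi := coord_le_enorm y i; have zj := coord_le_enorm z j.
by rewrite ler_wpM2l//; exact: ler_pM.
Qed.

(** On the ball of radius [2 r] centred at [- r e], the quadratic polynomial with
    gradient [p = P e] at [0] is hardly larger than at the boundary point [r e].
    A deviation [h] from this point costs [P |h|^2 / (4 r)] in the linear term,
    by the curvature of the sphere, and gains only [O(r |h|)] in the quadratic
    one. *)
Lemma quadratic_on_ball (X : 'M[R]_N) (p e h : V) (P B r k : R) :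
  0 < P -> 0 <= B -> 0 < r -> 0 < k ->
  (forall y z, dotv (y *m X) z <= B * enorm y * enorm z) ->
  p = P *: e -> enorm e = 1 -> 4 * B * r <= P -> 2 * r * B ^+ 2 <= k * P ->
  enorm (2 * r *: e + h) <= 2 * r ->
  dotv (r *: e + h) p + dotv ((r *: e + h) *m X) (r *: e + h) / 2 <=
  P * r + r ^+ 2 * dotv (e *m X) e / 2 + k * r ^+ 2.
Proof.
move=> P0 B0 r0 k0 XB -> e1 rB rk hr.
set s := enorm h; have s0 : 0 <= s by exact: enorm_ge0.
have ee : dotv e e = 1 by rewrite -enorm_sqr e1 expr1n.
have eh : 4 * r * dotv e h + s ^+ 2 <= 0.
  have : enorm (2 * r *: e + h) ^+ 2 <= (2 * r) ^+ 2.
    by rewrite lerXn2r ?nnegrE ?enorm_ge0//; lra.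
  rewrite enorm_sqr !(dotvDl, dotvDr, dotvZl, dotvZr) ee (dotvC h e) -(enorm_sqr h) -/s.
  by lra.
rewrite !(dotvDl, dotvDr, dotvZl, dotvZr) ee mulmxDl -scalemxAl.
rewrite !(dotvDl, dotvDr, dotvZl, dotvZr) (dotvC h e).
have b1 := XB e h; have b2 := XB h e; have b3 := XB h h.
rewrite e1 ?mulr1 -/s in b1 b2 b3.
have rb1 := ler_wpM2l (ltW r0) b1; have rb2 := ler_wpM2l (ltW r0) b2.
set E := dotv e h in eh *.
(* |h| B r <= P |h|^2 / (8 r) + 2 r^3 B^2 / P, multiplied by r P *)
have key : r * (B * s) + B * s * s / 2 + P * E <= k * r ^+ 2.
  rewrite -(ler_pM2l r0) -(ler_pM2l P0).
  have h1 : P * (P * (4 * r * E + s ^+ 2)) <= 0.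
    by rewrite pmulr_rle0// pmulr_rle0.
  have h2 : 4 * B * r * (P * s ^+ 2) <= P * (P * s ^+ 2).
    by rewrite ler_wpM2r// mulr_ge0 ?sqr_ge0// ltW.
  have h3 : 0 <= (P * s - 4 * B * r ^+ 2) ^+ 2 by exact: sqr_ge0.
  have h4 : 2 * r * B ^+ 2 * r ^+ 3 <= k * P * r ^+ 3.
    by rewrite ler_wpM2r// exprn_ge0// ltW.
  by lra.
by lra.
Qed.

(** Only a nonzero gradient [p] matters.  The midpoint inequality is used on the
    ball centred at [y = x - r p / |p|], at the point [x]: the linear terms of the
    Taylor expansions at [y] and at the opposite point cancel, and the quadratic
    ones add up to the infinity Laplacian. *)
Lemma cone_viscosity Om (O : V -> \bar R) w x phi : open Om -> Om x ->
  cone_above Om O w ->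
  (exists2 r, 0 < r & forall y z, enorm (y - x) <= r -> enorm (z - x) <= r ->
     (O z <= (w y)%:E)%E) ->
  C2_near x phi -> local_max_at (w \- phi) x -> 0 <= inf_laplacian phi x.
Proof.
move=> /open_enormP oOm Ox cw [r0 r00 hO] [U [oU Ux] ck] lmax.
rewrite /inf_laplacian; set p := grad phi x; set X := hess phi x.
have [->|p0] := eqVneq p 0; first by rewrite mul0mx dot0v.
pose P := enorm p; have P0 : 0 < P by rewrite enorm_gt0.
have [e pe e1] : exists2 e, p = P *: e & enorm e = 1.
  exists (P^-1 *: p); first by rewrite scalerA mulfV ?gt_eqF// scale1r.
  by rewrite enormZ ger0_norm ?invr_ge0 ?ltW// mulVf// gt_eqF.
rewrite pe -scalemxAl dotvZl dotvZr; set Q := dotv (e *m X) e.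
rewrite mulrA pmulr_rge0 ?mulr_gt0// leNgt; apply/negP => Q0.
(* the error terms below add up to 11 k r^2, which is less than - Q r^2 *)
pose k := - Q / 24; have k0 : 0 < k by rewrite /k; lra.
have [B B0 XB] := mulmx_form_bound X.
have [r1 r10 taylor] := C2_expansion oU Ux ck k0.
have [r2 r20 hmax] := (nbhs_enorm _ _).1 lmax.
have [r3 r30 hOm] := oOm x Ox.
pose d := Num.min (Num.min r0 r1) (Num.min r2 r3).
have d0 : 0 < d by rewrite !lt_min r00 r10 r20 r30.
have [dr0 dr1 dr2 dr3] : [/\ d <= r0, d <= r1, d <= r2 & d <= r3].
  by rewrite !ge_min !lexx !orbT.
pose r := Num.min (d / 4) (Num.min (P / (4 * (B + 1))) (k * P / (2 * (B ^+ 2 + 1)))).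
have B1 : 0 < 4 * (B + 1) by lra.
have B2 : 0 < 2 * (B ^+ 2 + 1) by have := sqr_ge0 B; lra.
have rr0 : 0 < r by rewrite !lt_min !divr_gt0// mulr_gt0.
have rd : 4 * r <= d.
  by have : r <= d / 4; [rewrite ge_min lexx|lra].
have rB : 4 * B * r <= P.
  have : r <= P / (4 * (B + 1)) by rewrite !ge_min lexx !orbT.
  by rewrite ler_pdivlMr//; lra.
have rk : 2 * r * B ^+ 2 <= k * P.
  have : r <= k * P / (2 * (B ^+ 2 + 1)) by rewrite !ge_min lexx !orbT.
  by rewrite ler_pdivlMr//; lra.
have touch v : enorm v < d -> w (x + v) <= w x + (dotv v p + dotv (v *m X) v / 2) + k * enorm v ^+ 2.
  move=> vd; have vx : enorm (x + v - x) = enorm v by rewrite addrAC subrr add0r.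
  have := hmax (x + v); rewrite vx => /(_ (lt_le_trans vd dr2)) /= m.
  have := taylor v (lt_le_trans vd dr1); rewrite -/p -/X ler_norml => /andP[_ t].
  by lra.
pose y := x - r *: e.
have yx : enorm (y - x) = r.
  by rewrite /y addrAC subrr add0r enormN enormZ e1 mulr1 ger0_norm ?ltW.
have near_x z : enorm (z - y) <= 2 * r -> enorm (z - x) <= 3 * r.
  by move=> zy; have := enorm_triangle y z x; rewrite yx; lra.
pose M := w x + (P * r + r ^+ 2 * Q / 2 + k * r ^+ 2) + k * (9 * r ^+ 2).
have hM z : enorm (z - y) <= 2 * r -> w z <= M.
  move=> zy; have zx := near_x z zy.
  pose h := z - x - r *: e.
  have zE : z - x = r *: e + h by rewrite /h [RHS]addrC subrK.
  have yE : z - y = 2 * r *: e + h.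
    rewrite (_ : 2 * r *: e = r *: e + r *: e); last by rewrite -scalerDl; congr (_ *: _); ring.
    by rewrite -addrA -zE /y opprD opprK addrA addrC.
  have zd : enorm (z - x) < d by lra.
  have := touch (z - x) zd; rewrite addrC subrK => /le_trans; apply.
  have := @quadratic_on_ball X p e h P B r k P0 B0 rr0 k0 XB pe e1 rB rk.
  rewrite -yE -zE -/Q => /(_ zy) q.
  have : k * enorm (z - x) ^+ 2 <= k * (9 * r ^+ 2).
    rewrite ler_pM2l// (_ : 9 * r ^+ 2 = (3 * r) ^+ 2); last by ring.
    by rewrite lerXn2r ?nnegrE ?enorm_ge0//; lra.
  by rewrite /M; lra.
have := cone_midpoint cw rr0 _ hM _ (_ : enorm (x - y) <= r).
rewrite {1}enormB yx lexx => H.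
have {}H : w x <= (w y + M) / 2.
  apply: H => // z /near_x zx; first by apply: hOm; lra.
  by apply: hO; rewrite ?yx; lra.
have er : enorm (- (r *: e)) = r by rewrite enormN enormZ e1 mulr1 ger0_norm// ltW.
have rd' : r < d by lra.
have := touch (- (r *: e)); rewrite er => /(_ rd').
have ep : dotv e p = P by rewrite pe dotvZr -enorm_sqr e1 expr1n mulr1.
rewrite -/y mulNmx -scalemxAl !dotvNl dotvNr !dotvZl dotvZr opprK ep -/Q.
have : 0 < r ^+ 2 by rewrite exprn_gt0.
have kQ : Q = - (24 * k) by rewrite /k; lra.
rewrite /M kQ in H *; move=> r2pos yle.
have : 0 < k * r ^+ 2 by rewrite mulr_gt0.
by lra.
Qed.

End cones_to_viscosity.

(** * Convergence and uniqueness *)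

Section assembly.
Context {R : realType} {N : nat}.
Local Notation V := 'rV[R]_N.
Implicit Types (x y z : V) (A Om : set V) (f w u : V -> R).

Lemma lipschitz_elip A f : [lipschitz f x | x in A] ->
  exists2 L, 0 <= L & elip L A f.
Proof.
move=> [M [_ h]]; exists (`|M| + 1); first by rewrite addr_ge0.
have ML : M < `|M| + 1 by apply: le_lt_trans (ler_norm _) _; rewrite ltrDl.
move=> x y Ax Ay; have := h _ ML (y, x) (conj Ay Ax) => /= hxy.
apply: le_trans (ler_norm _) _; apply: le_trans hxy _.
by rewrite ler_wpM2l ?addr_ge0// norm_le_enorm.
Qed.

Lemma elipW L L' A f : L <= L' -> elip L A f -> elip L' A f.
Proof.
by move=> LL h x y Ax Ay; apply: le_trans (h x y Ax Ay) _; rewrite ler_wpM2r ?enorm_ge0.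
Qed.

Lemma cone_above_eq Om (O : V -> \bar R) w w' :
  (forall x, closure Om x -> w x = w' x) -> cone_above Om O w -> cone_above Om O w'.
Proof.
move=> e h A x a b oA AOm nAx b0 OA bA y Ay.
rewrite -e; last exact/subset_closure/AOm.
apply: (h A x a b oA AOm nAx b0 OA) => // z cz nz.
by rewrite e; [exact: bA|exact: closureS cz].
Qed.

Lemma uniform_cvgP A (F : R -> V -> R) u :
  (forall e, 0 < e -> exists2 eta, 0 < eta &
     forall t x, 0 < t < eta -> A x -> `|F t x - u x| <= e) ->
  {uniform A, F t @[t --> 0^'+] --> u}.
Proof.
move=> h P /uniform_nbhs[E [entE EP]].
move: entE; rewrite -entourage_ballE => -[e /= e0 eE].
have e2 : 0 < e / 2 by rewrite divr_gt0.
have [eta eta0 heta] := h _ e2.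
exists eta => //= t.
rewrite /ball_ /= sub0r normrN => teta t0.
apply: EP => x Ax; apply: eE => /=.
rewrite /ball /= distrC; apply: le_lt_trans (heta t x _ Ax) _; last first.
  by rewrite ltr_pdivrMr// ltr_pMr// ltr1n.
by rewrite t0 /=; move: teta; rewrite gtr0_norm.
Qed.

(** [cone_comparison] for functions that are Lipschitz on the domain and the strip
    only: near the domain nothing changes under a Lipschitz extension. *)
Lemma compare_on_strip Om (Gam : set V) (Psi w1 w2 : V -> R) L rho : (0 < N)%N ->
  open Om -> bounded_set Om -> Om !=set0 -> 0 <= L -> 0 < rho ->
  closure Om `<=` Om `|` Gam ->
  (forall x y, closure Om x -> ~ Om y -> enorm (y - x) <= rho -> Gam y) ->
  elip L setT Psi -> elip L (Om `|` Gam) w1 -> elip L (Om `|` Gam) w2 ->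
  cone_above Om (EFin \o Psi) w1 -> cone_above Om (fun=> -oo%E) (\- w2) ->
  (forall x, Om x -> Psi x <= w2 x) -> (forall x, Gam x -> w1 x <= w2 x) ->
  forall x, Om x -> w1 x <= w2 x.
Proof.
move=> N0 oOm bOm [p Op] L0 rho0 clOm near lP l1 l2 c1 c2 Pw wG x Ox.
have Z0 : (Om `|` Gam) !=set0 by exists p; left.
have [g1 [lg1 e1]] := elip_extend Z0 L0 l1.
have [g2 [lg2 e2]] := elip_extend Z0 L0 l2.
rewrite -e1; last by left.
rewrite -e2; last by left.
apply: (@cone_comparison _ _ Om Psi g1 g2 L rho) => //.
- by apply: cone_above_eq c1 => y /clOm Zy; rewrite e1.
- by apply: cone_above_eq c2 => y /clOm Zy /=; rewrite e2.
- by move=> y Oy; rewrite e2; [exact: Pw|left].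
- move=> y z cy nOz zy; have Gz := near y z cy nOz zy.
  by rewrite e1 ?e2; [exact: wG|right|right].
Qed.

Lemma elip_open_continuous L A Om f x : 0 <= L -> elip L A f -> open Om ->
  Om `<=` A -> Om x -> {for x, continuous f}.
Proof.
move=> L0 lf oOm OmA Ox.
have cf := elip_within L0 lf; apply/continuous_enormP => e e0.
have [r r0 hr] := (within_enormP A f).1 cf x e (OmA x Ox) e0.
have [r' r'0 hr'] := (open_enormP Om).1 oOm x Ox.
exists (Num.min r r'); first by rewrite lt_min r0.
by move=> y; rewrite lt_min => /andP[yr yr']; apply: hr => //; exact/OmA/hr'.
Qed.

Lemma cones_solution Om (Gam : set V) (F Psi w : V -> R) L : open Om -> 0 <= L ->
  elip L setT Psi -> elip L (Om `|` Gam) w ->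
  cone_above Om (EFin \o Psi) w -> cone_above Om (fun=> -oo%E) (\- w) ->
  (forall x, Om x -> Psi x <= w x) -> (forall x, Gam x -> w x = F x) ->
  obstacle_solution Om Gam F Psi w.
Proof.
move=> oOm L0 lP lw c1 c2 Pw wF.
have cw x : Om x -> {for x, continuous w}.
  by move=> Ox; apply: (elip_open_continuous L0 lw oOm _ Ox) => y; left.
have super x phi : Om x -> C2_near x phi -> local_min_at (w \- phi) x ->
    0 <= - inf_laplacian phi x.
  move=> Ox [U [oU Ux] ck] lmin.
  rewrite -(inf_laplacian_opp oU ck Ux).
  apply: (cone_viscosity oOm Ox c2).
  - by exists 1 => // y z _ _; rewrite leNye.
  - by exists U; [split|exact: (Ck2_opp oU ck)].
  - by apply: filterS lmin => y /=; rewrite !opprK; lra.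
have sub x phi : Om x -> Psi x < w x -> C2_near x phi -> local_max_at (w \- phi) x ->
    - inf_laplacian phi x <= 0.
  move=> Ox Px c2phi lmax; rewrite oppr_le0.
  apply: (cone_viscosity oOm Ox c1) => //.
  have [r' r'0 hr'] := (open_enormP Om).1 oOm x Ox.
  have k0 : 0 < 2 * (L + 1) by rewrite mulr_gt0// ltr_wpDl.
  have d0 : 0 < w x - Psi x by rewrite subr_gt0.
  exists (Num.min (r' / 2) ((w x - Psi x) / (2 * (L + 1)))); first by rewrite lt_min !divr_gt0.
  move=> y z; rewrite !le_min => /andP[y1 y2] /andP[_ z2].
  have Oy : Om y by apply: hr'; lra.
  have := lw y x (or_introl Oy) (or_introl Ox); have := lP x z I I.
  rewrite (enormB x y) /= lee_fin.
  move: y2 z2; rewrite !ler_pdivlMr//.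
  by have := enorm_ge0 (y - x); have := enorm_ge0 (z - x); lra.
split=> //; first exact: elip_within lw.
by split; split=> [x [Ox _]|x phi [Ox Px]]; [exact: cw|exact: super|exact: cw|exact: sub].
Qed.

End assembly.

Theorem theorem5 (R : realType) (N : nat) (N_gt0 : (0 < N)%N)
    (Omega : set 'rV[R]_N) (Omega_dom : bounded_smooth_domain Omega)
    (gamma : R) (gamma_gt0 : 0 < gamma)
    (F : 'rV[R]_N -> R)
    (F_lip : [lipschitz F x | x in outer_strip Omega gamma])
    (Psi : 'rV[R]_N -> R) (Psi_lip : lipschitz Psi)
    (Psi_le_F : forall x, outer_strip Omega gamma x -> Psi x <= F x)
    (d : measure_display) (T : measurableType d) (P : probability T R)
    (coin : nat -> {RV P >-> bool}) (coin_fair : fair_coins coin)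
    (ueps : R -> 'rV[R]_N -> R)
    (ueps_value : forall eps, 0 < eps <= gamma ->
       game_value coin (outer_strip Omega gamma) F Psi eps Omega (ueps eps)) :
  exists u : 'rV[R]_N -> R,
    [/\ {uniform closure Omega, ueps eps @[eps --> 0^'+] --> u},
        obstacle_solution Omega (outer_strip Omega gamma) F Psi u
      & forall v, obstacle_solution Omega (outer_strip Omega gamma) F Psi v ->
          forall x, (Omega `|` outer_strip Omega gamma) x -> v x = u x].
Proof.
have [[oOm _ Om0] bOm _] := Omega_dom.
set Gam := outer_strip Omega gamma.
have [L1 L10 lF1] := lipschitz_elip F_lip.
have [L2 L20 lP2] := lipschitz_elip Psi_lip.
pose L := Num.max L1 L2.
have L0 : 0 <= L by rewrite le_max L10.
have lF : elip L Gam F by apply: elipW lF1; rewrite le_max lexx.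
have lP : elip L setT Psi by apply: elipW lP2; rewrite le_max lexx orbT.
have disj : forall x, Omega x -> ~ Gam x by exact: strip_disj.
have clOm : closure Omega `<=` Omega `|` Gam by exact: closure_domain.
have near_strip x y : closure Omega x -> ~ Omega y -> enorm (y - x) <= gamma -> Gam y.
  exact: strip_near.
have bZ : bounded_set (Omega `|` Gam) by exact: bounded_domain_strip.
have moves e x y : 0 < e <= gamma -> Omega x -> eball x e y -> (Omega `|` Gam) y.
  by move=> /andP[_ eg]; exact: strip_moves.
have [q bq] := bdry_neq0 oOm N_gt0 bOm Om0.
have Gq : Gam q by have /bdry_open[//|/clOm[]] := bq.
have [D hD] := @bounded_radius _ _ _ bZ q.
(* all payoffs are bounded, because the domain and the strip are *)
pose C := `|F q| + `|Psi q| + L * D.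
have payC x : (Omega `|` Gam) x -> `|payoff Gam F Psi x| <= C.
  move=> Zx; have xD := ler_wpM2l L0 (hD x Zx).
  rewrite /payoff; case: asboolP => [Gx|_].
    have := elip_norm lF Gq Gx; have := ler_normD (F x - F q) (F q); rewrite subrK.
    by have := normr_ge0 (Psi q); rewrite /C; lra.
  have := elip_norm lP (x := q) (y := x) I I.
  have := ler_normD (Psi x - Psi q) (Psi q); rewrite subrK.
  by have := normr_ge0 (F q); rewrite /C; lra.
have uC e x : 0 < e <= gamma -> (Omega `|` Gam) x -> `|ueps e x| <= C.
  move=> eg; have /andP[e0 _] := eg.
  exact: (value_bounded coin_fair e0 (fun x y => moves e x y eg) (ueps_value e eg) payC).
have uF e x : 0 < e <= gamma -> Gam x -> ueps e x = F x.
  move=> eg; have /andP[e0 _] := eg.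
  exact: (value_final coin_fair e0 (ueps_value e eg)).
have uP e x : 0 < e <= gamma -> Omega x -> Psi x <= ueps e x.
  move=> eg; have /andP[e0 _] := eg.
  exact: (value_ge_obstacle coin_fair e0 disj (ueps_value e eg)).
have usub e x : 0 < e <= gamma -> Omega x -> Psi x < ueps e x -> discrete_sub e (ueps e) x.
  move=> eg Ox Px dl dl0; have /andP[e0 _] := eg.
  exact: (value_sub coin_fair e0 disj (fun x y => moves e x y eg) (ueps_value e eg) Ox Px dl0).
have usuper e x : 0 < e <= gamma -> Omega x -> discrete_sub e (\- ueps e) x.
  move=> eg Ox dl dl0; have /andP[e0 _] := eg.
  have [b xb hb] := value_super coin_fair e0 disj (fun x y => moves e x y eg) (ueps_value e eg) Ox dl0.
  by exists b => // a /hb /=; lra.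
have ulip e x y : 0 < e <= gamma -> (Omega `|` Gam) x -> (Omega `|` Gam) y ->
    ueps e y - ueps e x <= L * enorm (y - x) + 6 * L * e.
  move=> eg; have /andP[e0 _] := eg.
  apply: (@discrete_lipschitz _ _ Omega Gam F Psi e L C) => //.
  - by move=> z t; exact: moves.
  - by move=> z; exact: uF.
  - by move=> z; exact: uP.
  - by move=> z; exact: usub.
  - by move=> z; exact: usuper.
  - by move=> z Oz; apply: uC => //; left.
have k0 : 0 <= 6 * L by rewrite mulr_ge0.
have uNlip e x y : 0 < e <= gamma -> (Omega `|` Gam) x -> (Omega `|` Gam) y ->
    (\- ueps e) y - (\- ueps e) x <= L * enorm (y - x) + 6 * L * e.
  by move=> eg Zx Zy /=; have := ulip e y x eg Zy Zx; rewrite enormB; lra.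
have uNC e x : 0 < e <= gamma -> (Omega `|` Gam) x -> `|(\- ueps e) x| <= C.
  by move=> eg Zx /=; rewrite normrN; exact: uC.
have [g lg upg] := upper_limit_exists bZ L0 k0 gamma_gt0 ulip uC.
have [h lh uph] := upper_limit_exists bZ L0 k0 gamma_gt0 uNlip uNC.
have cg : cone_above Omega (EFin \o Psi) g.
  exact: (@upper_limit_cone _ _ (Omega `|` Gam) ueps L C gamma _ _ Omega _ g lg upg).
have ch : cone_above Omega (fun=> -oo%E) h.
  apply: (@upper_limit_cone _ _ (Omega `|` Gam) (fun e => \- ueps e) L C gamma _ _ Omega _ h lh uph) => //.
  by move=> e x eg Ox _; exact: usuper.
have [gup glow] := upg; have [hup hlow] := uph.
have small (eta : R) : 0 < eta <= gamma -> exists2 e, 0 < e < eta & 0 < e <= gamma.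
  by move=> /andP[? ?]; exists (eta / 2); apply/andP; split; lra.
have gF x : Gam x -> g x = F x.
  move=> Gx; apply/eqP; rewrite eq_le; apply/andP; split; apply/ler_addgt0Pr => dl dl0.
    have [e /andP[e0 _] [eg ge]] := glow x dl gamma (or_intror Gx) dl0 gamma_gt0.
    by rewrite uF// ?e0// in ge; lra.
  have [eta etag he] := gup dl dl0; have [e e1 e2] := small eta etag.
  by rewrite -(uF e)//; apply: he => //; right.
have hF x : Gam x -> h x = - F x.
  move=> Gx; apply/eqP; rewrite eq_le; apply/andP; split; apply/ler_addgt0Pr => dl dl0.
    have [e /andP[e0 _] [eg he]] := hlow x dl gamma (or_intror Gx) dl0 gamma_gt0.
    by rewrite /= uF// ?e0// in he; lra.
  have [eta etag he] := hup dl dl0; have [e e1 e2] := small eta etag.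
  by rewrite -(uF e)//; apply: (he e) => //; right.
have gP x : Omega x -> Psi x <= g x.
  move=> Ox; apply/ler_addgt0Pr => dl dl0.
  have [eta etag he] := gup dl dl0; have [e e1 e2] := small eta etag.
  by apply: le_trans (uP e x e2 Ox) _; apply: he => //; left.
have hP x : Omega x -> Psi x <= - h x.
  move=> Ox; apply/ler_addgt0Pr => dl dl0.
  have [e /andP[e0 _] [eg he]] := hlow x dl gamma (or_introl Ox) dl0 gamma_gt0.
  have e2 : 0 < e <= gamma by rewrite e0.
  by have := uP e x e2 Ox; rewrite /= in he; lra.
(* the upper limit g of u^eps is its lower limit - h as well *)
have gh x : (Omega `|` Gam) x -> h x = - g x.
  case=> [Ox|Gx]; last by rewrite hF// gF.
  apply/eqP; rewrite eq_le; apply/andP; split.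
    rewrite lerNr; apply: (@compare_on_strip _ _ Omega Gam Psi g (\- h) L gamma) => //.
    - exact: elipN.
    - by rewrite (_ : \- \- h = h)//; apply/funext => y /=; rewrite opprK.
    - by move=> y Gy /=; rewrite gF// hF// opprK.
  apply/ler_addgt0Pr => dl dl0; have dl2 : 0 < dl / 2 by lra.
  have [eta /andP[eta0 etag] he] := gup _ dl2; have [eta' /andP[eta'0 eta'g] he'] := hup _ dl2.
  pose e := Num.min eta eta' / 2.
  have m0 : 0 < Num.min eta eta' by rewrite lt_min eta0.
  have [e1 e2] : e < eta /\ e < eta'.
    have : e < Num.min eta eta' by rewrite /e; lra.
    by rewrite lt_min => /andP.
  have e0 : 0 < e by rewrite /e; lra.
  have := he e x; rewrite e0 e1 => /(_ isT (or_introl Ox)).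
  have := he' e x; rewrite e0 e2 => /(_ isT (or_introl Ox)) /=.
  by lra.
have cNg : cone_above Omega (fun=> -oo%E) (\- g).
  by apply: cone_above_eq ch => x /clOm /gh.
exists g; split.
- apply: uniform_cvgP => dl dl0.
  have [eta /andP[eta0 etag] he] := gup _ dl0; have [eta' /andP[eta'0 eta'g] he'] := hup _ dl0.
  exists (Num.min eta eta'); first by rewrite lt_min eta0.
  move=> e x /andP[e0]; rewrite lt_min => /andP[e1 e2] /clOm Zx.
  have := he e x; rewrite e0 e1 => /(_ isT Zx).
  have := he' e x; rewrite e0 e2 => /(_ isT Zx) /=; rewrite gh//.
  by rewrite ler_norml => h1 h2; apply/andP; split; lra.
- exact: (@cones_solution _ _ Omega Gam F Psi g L).
move=> v sol x Zx; have [_ _ vP vF _] := sol.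
have [cv cNv] := solution_cones oOm bOm clOm sol.
have lv : elip L (Omega `|` Gam) v by exact: (@cone_lipschitz _ _ Omega Gam F Psi v L).
have [Ox|Gx] := Zx; last by rewrite vF// gF.
apply/eqP; rewrite eq_le; apply/andP; split.
- apply: (@compare_on_strip _ _ Omega Gam Psi v g L gamma) => // y Gy.
  by rewrite vF// gF.
- apply: (@compare_on_strip _ _ Omega Gam Psi g v L gamma) => // y Gy.
  by rewrite vF// gF.
Qed.
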